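(* Let $G$ act by isometries on a Gromov hyperbolic space $X$, let $x\in X$, and let $\mu$ be a countable, non-elementary, bounded, WPD probability measure on $G$. Then for every $K\ge0$ there are constants $N>0$, $B>0$, $c<1$ such that for all $n$ $$\mathbb P\big(|\mathrm{Stab}_K(x,w_nx)|\le N\big)\ge 1-Bc^{\sqrt n}$$ and $$\mathbb P\big(w_n\text{ is loxodromic and }|\mathrm{Stab}_K(p,w_np)|\le N\big)\ge 1-Bc^{\sqrt n},$$ where $p$ is a closest point projection of $x$ onto an axis $\alpha_{w_n}$ of $w_n$.
   Context: $X$ is $\delta$-hyperbolic geodesic, not necessarily proper. Loxodromic: positive translation length. Given $\delta$ there is $K_1$ such that every loxodromic $g$ has a $g$-invariant $(1,K_1)$-quasigeodesic (an ''axis'' $\alpha_g$). $\mathrm{Stab}_K(y,z)=\{g\in G:d(y,gy)\le K,d(z,gz)\le K\}$; loxodromic $h$ is WPD if for all $K>0,y$ some $\mathrm{Stab}_K(y,h^My)$ is finite. $w_n=g_1\cdots g_n$, $g_i$ i.i.d. $\sim\mu$; $\Gamma_\mu$ semigroup generated by $\mathrm{supp}\mu$; countable: countable support; non-elementary: $\Gamma_\mu$ contains two loxodromics with disjoint boundary fixed sets; bounded: $\{gx:g\in\mathrm{supp}\mu\}$ bounded; WPD: $\Gamma_\mu$ contains a WPD element of $G$. *)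

(* Defs.v *)
From Stdlib Require Import Reals List.
Open Scope R_scope.

Record metric_space := MetricSpace {
  pt :> Type;
  dist : pt -> pt -> R;
  dist_refl : forall x, dist x x = 0;
  dist_sym : forall x y, dist x y = dist y x;
  dist_tri : forall x y z, dist x z <= dist x y + dist y z;
  dist_sep : forall x y, dist x y = 0 -> x = y }.
Arguments dist {m} _ _.

Definition gromov_product {X : metric_space} (w y z : X) : R :=
  (dist y w + dist z w - dist y z) / 2.

Definition geodesic_space (X : metric_space) : Prop :=
  forall y z : X, exists gam : R -> X,
    gam 0 = y /\ gam (dist y z) = z /\
    forall s t, 0 <= s <= dist y z -> 0 <= t <= dist y z ->
      dist (gam s) (gam t) = Rabs (s - t).

Definition hyperbolic (X : metric_space) (delta : R) : Prop :=
  forall w y z v : X,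
    gromov_product w y z >= Rmin (gromov_product w y v) (gromov_product w v z) - delta.

Record group := Group {
  gcar :> Type;
  gmul : gcar -> gcar -> gcar;
  gone : gcar;
  ginv : gcar -> gcar;
  gmul_assoc : forall a b c, gmul a (gmul b c) = gmul (gmul a b) c;
  gmul_1l : forall a, gmul gone a = a;
  gmul_1r : forall a, gmul a gone = a;
  gmul_Vl : forall a, gmul (ginv a) a = gone;
  gmul_Vr : forall a, gmul a (ginv a) = gone }.
Arguments gmul {g} _ _.
Arguments gone {g}.
Arguments ginv {g} _.

Fixpoint gpow {G : group} (g : G) (n : nat) : G :=
  match n with O => gone | S m => gmul g (gpow g m) end.

Definition is_isometric_action (G : group) (X : metric_space) (act : G -> X -> X) : Prop :=
  (forall y, act gone y = y) /\
  (forall g h y, act (gmul g h) y = act g (act h y)) /\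
  (forall g y z, dist (act g y) (act g z) = dist y z).

Section Defs.
Context {G : group} {X : metric_space} (act : G -> X -> X).

Definition loxodromic (g : G) : Prop :=
  exists (x0 : X) (l : R), 0 < l /\
    Un_cv (fun n => dist x0 (act (gpow g n) x0) / INR n) l.

(** Two sequences converge to the same point of the Gromov boundary
    (based at x); with u = v this says u converges at infinity. *)
Definition same_boundary_point (x : X) (u v : nat -> X) : Prop :=
  forall M : R, exists N0 : nat, forall n m, (N0 <= n)%nat -> (N0 <= m)%nat ->
    gromov_product x (u n) (v m) >= M.

(** Semigroup Gamma_mu generated by the support of mu = sum_k p k * delta_(a k) *)
Inductive in_semigroup (a : nat -> G) (p : nat -> R) : G -> Prop :=
| sg_gen k : 0 < p k -> in_semigroup a p (a k)
| sg_mul g h : in_semigroup a p g -> in_semigroup a p h -> in_semigroup a p (gmul g h).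

(** g has boundary fixed points g^{+} = lim g^n x, g^{-} = lim g^{-n} x;
    non-elementary: two loxodromics in Gamma_mu with disjoint fixed sets *)
Definition non_elementary (x : X) (a : nat -> G) (p : nat -> R) : Prop :=
  exists g h, in_semigroup a p g /\ in_semigroup a p h /\
    loxodromic g /\ loxodromic h /\
    forall u v, In u (g :: ginv g :: nil) -> In v (h :: ginv h :: nil) ->
      ~ same_boundary_point x (fun n => act (gpow u n) x) (fun n => act (gpow v n) x).

Definition Stab (K : R) (y z : X) (g : G) : Prop :=
  dist y (act g y) <= K /\ dist z (act g z) <= K.

Definition card_le (P : G -> Prop) (N : nat) : Prop :=
  forall l : list G, NoDup l -> (forall g, In g l -> P g) -> (length l <= N)%nat.

Definition finite_set (P : G -> Prop) : Prop :=
  exists l : list G, forall g, P g -> In g l.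

Definition WPD (h : G) : Prop :=
  loxodromic h /\
  forall (K : R) (y : X), 0 < K ->
    exists M : nat, (0 < M)%nat /\ finite_set (Stab K y (act (gpow h M) y)).

Definition has_WPD (a : nat -> G) (p : nat -> R) : Prop :=
  exists h, in_semigroup a p h /\ WPD h.

Definition bounded_measure (x : X) (a : nat -> G) (p : nat -> R) : Prop :=
  exists Rb : R, forall k, 0 < p k -> dist x (act (a k) x) <= Rb.

Definition is_axis (K1 : R) (g : G) (alpha : R -> X) : Prop :=
  (forall s t, Rabs (s - t) - K1 <= dist (alpha s) (alpha t) <= Rabs (s - t) + K1) /\
  (forall t, exists s, act g (alpha t) = alpha s) /\
  (forall s, exists t, act g (alpha t) = alpha s).

Definition closest_point (C : R) (y : X) (alpha : R -> X) (q : X) : Prop :=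
  exists t, q = alpha t /\ forall s, dist y (alpha t) <= dist y (alpha s) + C.

End Defs.

Definition is_prob_seq (p : nat -> R) : Prop :=
  (forall k, 0 <= p k) /\ infinite_sum p 1.

(** walk_prob a p n E r : P(E(w_n)) = r, where w_n = g_1 ... g_n with g_i
    i.i.d. of law mu = sum_k p k * delta_(a k). Uses
    P(E(w_(n+1))) = sum_k p k * P(E(a k * w_n)). *)
Inductive walk_prob {G : group} (a : nat -> G) (p : nat -> R) :
    nat -> (G -> Prop) -> R -> Prop :=
| wp0_in (E : G -> Prop) : E gone -> walk_prob a p O E 1
| wp0_out (E : G -> Prop) : ~ E gone -> walk_prob a p O E 0
| wpS (n : nat) (E : G -> Prop) (f : nat -> R) (r : R) :
    (forall k, walk_prob a p n (fun w => E (gmul (a k) w)) (f k)) ->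
    infinite_sum (fun k => p k * f k) r ->
    walk_prob a p (S n) E r.

(* Main.v *)
Require Import Defs.
From Stdlib Require Import Reals List Lra Lia Psatz Classical ClassicalEpsilon FinFun.
From Coquelicot Require Import Coquelicot.
Import Defs.
Open Scope R_scope.

(** Let f_0, ..., f_63 be a Schottky family in the semigroup: every point of X has
    bounded Gromov product at x with all but at most one f_i x, and likewise for the inverses. Let hM be a WPD power.
    Group the letters of w_n into nested pairs, the i-th block from the left with the i-th block from
    the right; with positive probability such a pair reads (f_i hM f_j, f_k), so that
    w = A f_i hM f_j N f_k B with A, B determined by the outer pairs and N by the inner ones.
    Given A and B, and given N, all but a proportion 4/64 of the triples (i, j, k) avoid backtracking
    with A, B and the cyclic word BA, respectively with N. Reading the pairs from outside in and
    from inside out, the probability that every pair fails is exponentially small.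
    One successful pair makes w loxodromic, and both ends of the corresponding translate of
    [x, hM x] lie near [x, w x] and near every axis of w, hence near [p, w p]. An element moving the
    ends of such a segment by at most K moves these two points by at most K + const, and only
    finitely many elements do that. *)

(** * Gromov products and isometric actions *)

Notation gp := gromov_product.

Section GromovProduct.
Context {X : metric_space}.
Implicit Types u v w y z : X.

Lemma dist_ge0 y z : 0 <= dist y z.
Proof.
pose proof (dist_tri X y z y). rewrite (dist_refl X) in H.
pose proof (dist_sym X y z). lra.
Qed.

Lemma gp_sym w y z : gp w y z = gp w z y.
Proof. unfold gp. rewrite (dist_sym X y z). lra. Qed.

Lemma gp_ge0 w y z : 0 <= gp w y z.
Proof.
unfold gp. pose proof (dist_tri X y w z). rewrite (dist_sym X w z) in H. lra.
Qed.

Lemma gp_le_dist w y z : gp w y z <= dist w y.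
Proof.
unfold gp. pose proof (dist_tri X z y w). pose proof (dist_sym X w y).
pose proof (dist_sym X y z). lra.
Qed.

Lemma gp_flip w y z : gp w y z + gp y w z = dist w y.
Proof.
unfold gp. rewrite (dist_sym X w y), (dist_sym X w z), (dist_sym X y z). lra.
Qed.

Lemma gp_lip w y y' z : gp w y z <= gp w y' z + dist y y'.
Proof.
unfold gp. pose proof (dist_tri X y y' w). pose proof (dist_tri X y' y z).
rewrite (dist_sym X y' y) in H0. lra.
Qed.

Lemma gp_lip_base w w' y z : gp w y z <= gp w' y z + dist w w'.
Proof.
unfold gp. pose proof (dist_tri X y w' w). pose proof (dist_tri X z w' w).
rewrite (dist_sym X w' w) in *. lra.
Qed.

Context (delta : R).
Context (delta0 : 0 <= delta).
Context (Xhyp : hyperbolic X delta).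

Lemma gp_hyp w y v z :
  gp w y v <= gp w y z + delta \/ gp w v z <= gp w y z + delta.
Proof.
pose proof (Xhyp w y z v) as H. unfold Rmin in H.
destruct (Rle_dec _ _); [left|right]; lra.
Qed.

Lemma four_point y z u v :
  dist y z + dist u v <= dist y u + dist z v + 2 * delta \/
  dist y z + dist u v <= dist y v + dist z u + 2 * delta.
Proof.
destruct (gp_hyp u y v z) as [H|H]; unfold gp in H;
rewrite ?(dist_sym X v u), ?(dist_sym X z v) in *; [right|left]; lra.
Qed.

(** By [gp_flip] the product of [u] and [v] at [z] exceeds [c + delta], so hyperbolicity at [z] can
    only act through the product of [y] and [v]. This is the local-to-global step for all later
    paths: a turn keeps its bound up to one [delta] when the path continues past a long segment. *)
Lemma gp_extend_r y z u v c c' :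
  gp z y u <= c -> gp u z v <= c' -> c + c' + delta < dist z u ->
  gp z y v <= c + delta.
Proof.
intros H1 H2 H3. pose proof (gp_flip z u v).
destruct (gp_hyp z y v u); [lra|]. rewrite (gp_sym z v u) in *. lra.
Qed.

Lemma gp_extend_l y z u v c c' :
  gp z y u <= c -> gp u z v <= c' -> c + c' + delta < dist z u ->
  gp u y v <= c' + delta.
Proof.
intros H1 H2 H3. rewrite gp_sym.
apply (gp_extend_r v u z y c' c).
- now rewrite gp_sym.
- now rewrite gp_sym.
- rewrite (dist_sym X). lra.
Qed.

(** The error does not accumulate: [gp_extend_l] takes the new bound from the local hypothesis [c]
    and uses the inductive bound [c + delta] only to check the length of the segment. *)
Lemma chain_step (y : nat -> X) c L :
  (forall i, gp (y (S i)) (y i) (y (S (S i))) <= c) ->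
  (forall i, L <= dist (y i) (y (S i))) -> 2 * c + 2 * delta < L ->
  forall n, gp (y (S n)) (y O) (y (S (S n))) <= c + delta /\
    dist (y O) (y (S n)) + (L - 2 * (c + delta)) <= dist (y O) (y (S (S n))).
Proof.
intros Hc HL Hlt n.
assert (A : gp (y (S n)) (y O) (y (S (S n))) <= c + delta).
{ induction n as [|n IH].
  - specialize (Hc O). lra.
  - eapply gp_extend_l; [exact IH|apply Hc|]. specialize (HL (S n)). lra. }
split; [exact A|]. unfold gp in A. specialize (HL (S n)).
rewrite (dist_sym X (y (S (S n))) (y (S n))) in A. lra.
Qed.

(** In the four-point inequality for [z], [z'], [p], [q] both alternatives are at most
    [dist p z + dist q z + K], and this sum of distances exceeds [dist p q] by at most [2 * c]. *)
Lemma dist_near_segment p q z z' K c :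
  gp z p q <= c -> Rabs (dist p z' - dist p z) <= K ->
  Rabs (dist q z' - dist q z) <= K -> dist z z' <= K + 2 * c + 2 * delta.
Proof.
intros H H1 H2. apply Rabs_le_between in H1, H2. unfold gp in H.
pose proof (four_point z z' p q).
rewrite (dist_sym X z p), (dist_sym X z q), (dist_sym X z' p), (dist_sym X z' q) in *.
lra.
Qed.

End GromovProduct.

(** * Group identities *)

Section Group.
Context {G : group}.
Implicit Types a b c : G.

Lemma gmulK a b : gmul (gmul a b) (ginv b) = a.
Proof. now rewrite <- gmul_assoc, gmul_Vr, gmul_1r. Qed.

Lemma gmulKV a b : gmul (gmul a (ginv b)) b = a.
Proof. now rewrite <- gmul_assoc, gmul_Vl, gmul_1r. Qed.

Lemma gmul_cancel_r a b c : gmul a c = gmul b c -> a = b.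
Proof. intros H. now rewrite <- (gmulK a c), H, gmulK. Qed.

Lemma gmul_cancel_l a b c : gmul c a = gmul c b -> a = b.
Proof.
intros H. now rewrite <- (gmul_1l G a), <- (gmul_1l G b), <- (gmul_Vl G c), <- !gmul_assoc, H.
Qed.

Lemma ginv_mul a b : ginv (gmul a b) = gmul (ginv b) (ginv a).
Proof.
apply (gmul_cancel_r _ _ (gmul a b)).
now rewrite gmul_Vl, gmul_assoc, gmulKV, gmul_Vl.
Qed.

Lemma ginvK a : ginv (ginv a) = a.
Proof. apply (gmul_cancel_r _ _ (ginv a)). now rewrite gmul_Vl, gmul_Vr. Qed.

Lemma ginv1 : ginv (@gone G) = gone.
Proof. apply (gmul_cancel_r _ _ gone). now rewrite gmul_Vl, gmul_1r. Qed.

Lemma gpow_add a m n : gpow a (m + n) = gmul (gpow a m) (gpow a n).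
Proof.
induction m as [|m IH]; simpl.
- now rewrite gmul_1l.
- now rewrite IH, gmul_assoc.
Qed.

Lemma gpow_Sr a n : gpow a (S n) = gmul (gpow a n) a.
Proof.
replace (S n) with (n + 1)%nat by lia. rewrite gpow_add. simpl. now rewrite gmul_1r.
Qed.

Lemma gpow_inv a n : gpow (ginv a) n = ginv (gpow a n).
Proof.
induction n as [|n IH].
- simpl. now rewrite ginv1.
- rewrite (gpow_Sr a n), ginv_mul. simpl. now rewrite IH.
Qed.

Lemma gpow_mul a m n : gpow a (m * n) = gpow (gpow a m) n.
Proof.
induction n as [|n IH].
- now rewrite Nat.mul_0_r.
- rewrite Nat.mul_succ_r, Nat.add_comm, gpow_add, IH. reflexivity.
Qed.

Lemma gpow_conj a b n :
  gpow (gmul (gmul a b) (ginv a)) n = gmul (gmul a (gpow b n)) (ginv a).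
Proof.
induction n as [|n IH]; simpl.
- now rewrite gmul_1r, gmul_Vr.
- rewrite IH, !gmul_assoc, gmulKV. reflexivity.
Qed.

End Group.

(** * Isometric actions and orbits with little backtracking *)

Section Action.
Context {G : group} {X : metric_space} (act : G -> X -> X).
Context (delta : R).
Context (delta0 : 0 <= delta).
Context (Xhyp : hyperbolic X delta).
Context (isom : is_isometric_action G X act).

Lemma act1 y : act gone y = y.
Proof. apply isom. Qed.

Lemma act_act g h y : act g (act h y) = act (gmul g h) y.
Proof. symmetry. apply isom. Qed.

Lemma dist_act g y z : dist (act g y) (act g z) = dist y z.
Proof. apply isom. Qed.

Lemma gp_act g w y z : gp (act g w) (act g y) (act g z) = gp w y z.
Proof. unfold gp. now rewrite !dist_act. Qed.

Lemma dist_inv g y : dist y (act (ginv g) y) = dist y (act g y).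
Proof. rewrite <- (dist_act g), act_act, gmul_Vr, act1. apply (dist_sym X). Qed.

(** The product is the turn at [g y] of the path [y], [g y], [g h y], moved back to [y]. Conditions
    against backtracking in words are stated in this form below. *)
Lemma dist_mul g h y :
  dist y (act (gmul g h) y) = dist y (act g y) + dist y (act h y)
    - 2 * gp y (act (ginv g) y) (act h y).
Proof.
unfold gp. rewrite (dist_sym X (act _ y) y), (dist_sym X (act h y) y), dist_inv.
rewrite <- (dist_act g (act (ginv g) y)), !act_act, gmul_Vr, act1. lra.
Qed.

Lemma dist_tail g h y : dist (act (gmul g h) y) (act g y) = dist y (act h y).
Proof. rewrite <- act_act, dist_act. apply (dist_sym X). Qed.

Lemma dist_gpow_le g y n : dist y (act (gpow g n) y) <= INR n * dist y (act g y).
Proof.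
induction n as [|n IH].
- simpl. rewrite act1, (dist_refl X). lra.
- pose proof (dist_tri X y (act g y) (act (gpow g (S n)) y)).
  simpl gpow in H at 2. rewrite <- (act_act g), dist_act in H. rewrite S_INR. simpl gpow.
  rewrite <- act_act. simpl gpow in H. rewrite <- act_act in H. lra.
Qed.

Section OrbitChain.
Context (f : G) (y : X) (c L : R).
Context (Hc : gp y (act (ginv f) y) (act f y) <= c).
Context (HL : L <= dist y (act f y)).
Context (HcL : 2 * c + 3 * delta < L).

Lemma gpow_pred n : gpow f n = gmul (gpow f (S n)) (ginv f).
Proof. now rewrite gpow_Sr, gmulK. Qed.

Lemma orbit_step n :
  gp y (act (gpow (ginv f) (S n)) y) (act f y) <= c + delta /\
  dist y (act (gpow f (S n)) y) + (L - 2 * (c + delta)) <= dist y (act (gpow f (S (S n))) y).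
Proof.
destruct (chain_step delta delta0 Xhyp (fun i => act (gpow f i) y) c L) with (n := n) as [A B].
- intros i. rewrite (gpow_pred i), (gpow_Sr f (S i)), <- !act_act, gp_act. exact Hc.
- intros i. rewrite (gpow_Sr f i), <- act_act, dist_act. exact HL.
- lra.
- change (gpow f 0) with (@gone G) in *. rewrite act1 in *. split; [|exact B].
  rewrite <- (gp_act (gpow f (S n))), !act_act, <- gpow_Sr, gpow_inv, gmul_Vr, act1.
  exact A.
Qed.

Lemma orbit_growth n :
  INR n * (L - 2 * (c + delta)) <= dist y (act (gpow f n) y).
Proof.
destruct n as [|n].
- simpl. pose proof (dist_ge0 y (act gone y)). lra.
- induction n as [|n IH].
  + pose proof (gp_ge0 y (act (ginv f) y) (act f y)). simpl. rewrite gmul_1r. lra.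
  + destruct (orbit_step n) as [_ A]. rewrite S_INR. lra.
Qed.

End OrbitChain.

(** [orbit_step] for [f] and for its inverse bounds the turns at [y] and [f y]; [gp_extend_r] joins
    them across the segment between, whose length condition is [2 * c + 3 * delta < L]. *)
Lemma orbit_two_sided f y c L :
  gp y (act (ginv f) y) (act f y) <= c -> L <= dist y (act f y) ->
  2 * c + 3 * delta < L -> forall n m,
  gp y (act (gpow (ginv f) n) y) (act (gpow f m) y) <= c + 2 * delta.
Proof.
intros Hc HL HcL n m.
assert (c0 : 0 <= c) by (pose proof (gp_ge0 y (act (ginv f) y) (act f y)); lra).
destruct n as [|n].
{ pose proof (gp_le_dist y (act (gpow (ginv f) 0) y) (act (gpow f m) y)) as A.
  simpl in *. rewrite act1 in *. rewrite (dist_refl X) in A. lra. }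
destruct m as [|m].
{ rewrite gp_sym.
  pose proof (gp_le_dist y (act (gpow f 0) y) (act (gpow (ginv f) (S n)) y)) as A.
  simpl in *. rewrite act1 in *. rewrite (dist_refl X) in A. lra. }
destruct (orbit_step f y c L Hc HL HcL n) as [A _].
destruct m as [|m].
{ replace (gpow f 1) with f by (simpl; now rewrite gmul_1r). lra. }
destruct (orbit_step (ginv f) y c L) with (n := m) as [B _].
- rewrite ginvK, gp_sym. exact Hc.
- rewrite dist_inv. exact HL.
- exact HcL.
- rewrite ginvK in B. rewrite gp_sym in B.
  rewrite <- (gp_act f), !act_act, gmul_Vr, act1 in B.
  change (gmul f (gpow f (S m))) with (gpow f (S (S m))) in B.
  replace (c + 2 * delta) with (c + delta + delta) by lra.
  eapply gp_extend_r; [exact Xhyp|exact A|exact B|lra].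
Qed.


(** * Loxodromic elements and their boundary points *)

(** By [dist_mul] this says that the orbit of [u^p] has steps longer than twice its turn by at least
    [b], as the orbit lemmas require. *)
Lemma loxodromic_doubling u y b : loxodromic act u ->
  exists p, (0 < p)%nat /\ dist y (act (gpow u p) y) + b <= dist y (act (gpow u (2 * p)) y).
Proof.
intros (x0 & l & l0 & Hl).
(* Ratios within [l / 8] of [l] make the displacement of [u^(2p)] at [x0] exceed that of [u^p] by
   more than [l * p / 2]; moving the base point to [y] costs [2 * D] for each. *)
destruct (Hl (l / 8)) as [N HN]; [lra|].
set (D := dist y x0).
destruct (INR_unbounded (2 * (b + 4 * D) / l)) as [n0 Hn0].
set (p := (S (max N n0))).
assert (Hp : 0 < INR p) by (apply lt_0_INR; lia).
assert (Hpb : b + 4 * D <= INR p * (l / 2)).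
{ assert (INR n0 <= INR p) by (apply le_INR; lia).
  apply Rmult_lt_compat_r with (r := l / 2) in Hn0; [|lra].
  replace (2 * (b + 4 * D) / l * (l / 2)) with (b + 4 * D) in Hn0 by (field; lra).
  assert (INR n0 * (l / 2) <= INR p * (l / 2)) by (apply Rmult_le_compat_r; lra). lra. }
assert (Hbase : forall g, Rabs (dist y (act g y) - dist x0 (act g x0)) <= 2 * D).
{ intros g. apply Rabs_le.
  pose proof (dist_tri X y x0 (act g y)). pose proof (dist_tri X x0 (act g x0) (act g y)).
  pose proof (dist_tri X x0 y (act g x0)). pose proof (dist_tri X y (act g y) (act g x0)).
  rewrite dist_act, ?(dist_sym X x0 y) in *. unfold D. lra. }
exists p. split; [unfold p; lia|].
pose proof (HN p ltac:(unfold p; lia)) as H1. pose proof (HN (2 * p)%nat ltac:(unfold p; lia)) as H2.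
unfold R_dist in H1, H2. apply Rabs_def2 in H1, H2.
pose proof (Hbase (gpow u p)) as B1. pose proof (Hbase (gpow u (2 * p))) as B2.
apply Rabs_le_between in B1, B2.
rewrite mult_INR in H2. change (INR 2) with 2 in H2.
set (d1 := dist x0 (act (gpow u p) x0)) in *. set (d2 := dist x0 (act (gpow u (2 * p)) x0)) in *.
assert (E1 : d1 < (l + l / 8) * INR p) by (apply (Rlt_div_l d1); lra).
assert (E2 : (l - l / 8) * (2 * INR p) < d2) by (apply (Rlt_div_r _ d2); lra).
nra.
Qed.

(** A power [f = u^p] has a quasigeodesic orbit, on which the product of two points is the distance
    to the earlier one up to a constant; all other powers of [u] stay within [E] of that orbit. *)
Lemma loxodromic_gp_diverges u y M : loxodromic act u ->
  exists N, forall n m, (N <= n)%nat -> (N <= m)%nat ->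
  M <= gp y (act (gpow u n) y) (act (gpow u m) y).
Proof.
intros Hu.
destruct (loxodromic_doubling u y (4 * delta + 1) Hu) as (p & p0 & Hp).
set (f := gpow u p) in *.
set (c := gp y (act (ginv f) y) (act f y)).
assert (Hc : 2 * c + 4 * delta + 1 <= dist y (act f y)).
{ pose proof (dist_mul f f y) as E. unfold c. replace (2 * p)%nat with (p + p)%nat in Hp by lia.
  rewrite gpow_add in Hp. fold f in Hp. lra. }
set (L := dist y (act f y)) in *.
set (E := INR p * dist y (act u y)).
destruct (INR_unbounded (M + c + 2 * delta + 2 * E)) as [q0 Hq0].
assert (Hf : forall q k, (q0 <= q)%nat ->
  M + 2 * E <= gp y (act (gpow f q) y) (act (gpow f (q + k)) y)).
{ intros q k Hq.
  pose proof (orbit_two_sided f y c L (Rle_refl _) (Rle_refl _) ltac:(lra) q k) as A.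
  rewrite <- (gp_act (gpow f q)), !act_act, <- gpow_add, gpow_inv, gmul_Vr, act1 in A.
  pose proof (gp_flip (act (gpow f q) y) y (act (gpow f (q + k)) y)) as B.
  pose proof (orbit_growth f y c L (Rle_refl _) (Rle_refl _) ltac:(lra) q) as C.
  rewrite (dist_sym X y) in C.
  assert (INR q0 <= INR q) by (apply le_INR; lia).
  pose proof (pos_INR q). nra. }
assert (Hdiv : forall n, dist (act (gpow f (n / p)) y) (act (gpow u n) y) <= E).
{ intros n. unfold f. rewrite (Nat.div_mod_eq n p) at 2.
  rewrite gpow_add, gpow_mul, <- act_act, dist_act.
  eapply Rle_trans; [apply dist_gpow_le|]. apply Rmult_le_compat_r; [apply dist_ge0|].
  apply le_INR. pose proof (Nat.mod_upper_bound n p). lia. }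
assert (main : forall n m, (p * q0 <= n)%nat -> (n <= m)%nat ->
  M <= gp y (act (gpow u n) y) (act (gpow u m) y)).
{ intros n m Hn Hm.
  assert (q0 <= n / p)%nat by (apply Nat.div_le_lower_bound; lia).
  assert (n / p <= m / p)%nat by (apply Nat.Div0.div_le_mono; lia).
  specialize (Hf (n / p)%nat (m / p - n / p)%nat H).
  replace (n / p + (m / p - n / p))%nat with (m / p)%nat in Hf by lia.
  pose proof (gp_lip y (act (gpow f (n / p)) y) (act (gpow u n) y) (act (gpow f (m / p)) y)).
  pose proof (gp_lip y (act (gpow f (m / p)) y) (act (gpow u m) y) (act (gpow u n) y)).
  pose proof (Hdiv n). pose proof (Hdiv m).
  pose proof (gp_sym y (act (gpow u n) y) (act (gpow f (m / p)) y)).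
  pose proof (gp_sym y (act (gpow u m) y) (act (gpow u n) y)).
 lra. }
exists (p * q0)%nat. intros n m Hn Hm.
destruct (Nat.le_ge_cases n m); [now apply main|]. rewrite gp_sym. now apply main.
Qed.

Lemma loxodromic_dist_diverges u y M : loxodromic act u ->
  exists N, forall n, (N <= n)%nat -> M <= dist y (act (gpow u n) y).
Proof.
intros Hu. destruct (loxodromic_gp_diverges u y M Hu) as [N HN].
exists N. intros n Hn. eapply Rle_trans; [apply (HN n n Hn Hn)|apply gp_le_dist].
Qed.

(** Fekete's lemma. [loxodromic] asks that the limit of displacement over [n] exists, not only that
    displacement grows linearly. *)
Lemma fekete (b : nat -> R) k : 0 < k ->
  (forall n m, b (n + m)%nat <= b n + b m) -> (forall n, INR n * k <= b n) ->
  exists l, 0 < l /\ Un_cv (fun n => b n / INR n) l.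
Proof.
intros k0 Hsub Hlow.
(* The limit is the infimum of the ratios [b n / n] with [n] positive, obtained as minus the
   supremum [s] of their negatives. *)
destruct (completeness (fun t => exists n, t = - (b (S n) / INR (S n)))) as [s [Hs1 Hs2]].
{ exists (- k). intros t [n ->]. specialize (Hlow (S n)).
  pose proof (lt_0_INR (S n) ltac:(lia)).
  assert (k <= b (S n) / INR (S n)) by (apply Rle_div_r; lra). lra. }
{ now exists (- (b 1%nat / INR 1)), O. }
assert (Hsk : s <= - k).
{ apply Hs2. intros t [n ->]. specialize (Hlow (S n)).
  pose proof (lt_0_INR (S n) ltac:(lia)).
  assert (k <= b (S n) / INR (S n)) by (apply Rle_div_r; lra). lra. }
exists (- s). split; [lra|]. intros e e0.
assert (Hp : exists p, b (S p) / INR (S p) < - s + e / 2).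
{ apply NNPP. intros Hn. assert (s <= s - e / 2); [|lra].
  apply Hs2. intros t [n ->]. apply Rnot_lt_le. intros H. apply Hn. exists n. lra. }
destruct Hp as [p0 Hp]. set (p := S p0) in *.
pose proof (lt_0_INR p ltac:(lia)) as p1.
assert (b0 : forall n, 0 <= b n).
{ intros n. eapply Rle_trans; [|apply Hlow]. pose proof (pos_INR n). nra. }
assert (Hmul : forall m n, b (m * n)%nat <= INR n * b m + b O).
{ intros m n. induction n as [|n IH].
  - rewrite Nat.mul_0_r. simpl. lra.
  - rewrite Nat.mul_succ_r, S_INR. specialize (Hsub (m * n)%nat m). lra. }
set (E := INR p * b 1%nat + 2 * b O).
destruct (INR_unbounded (2 * E / e)) as [n0 Hn0].
exists (S n0). intros n Hn.
pose proof (lt_0_INR n ltac:(lia)) as n1.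
assert (Hlo : - s <= b n / INR n).
{ assert (- (b n / INR n) <= s); [|lra]. apply Hs1. destruct n; [lia|]. now exists n. }
(* Split [n] into [n / p] blocks of length [p] and a remainder; [E] bounds the error uniformly in
   [n]. *)
assert (Hup : b n <= INR n * (b p / INR p) + E).
{ pose proof (Hsub (p * (n / p))%nat (n mod p)) as A. rewrite <- Nat.div_mod_eq in A.
  pose proof (Hmul p (n / p)%nat) as B. pose proof (Hmul 1%nat (n mod p)) as C.
  rewrite Nat.mul_1_l in C.
  assert (INR (n mod p) * b 1%nat <= INR p * b 1%nat).
  { apply Rmult_le_compat_r; [apply b0|]. apply le_INR. pose proof (Nat.mod_upper_bound n p). lia. }
  assert (INR (n / p) * b p <= INR n * (b p / INR p)).
  { replace (INR n * (b p / INR p)) with (INR n / INR p * b p) by (field; lra).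
    apply Rmult_le_compat_r; [apply b0|]. apply Rle_div_r; [lra|].
    rewrite <- mult_INR. apply le_INR. rewrite (Nat.div_mod_eq n p) at 2. lia. }
  unfold E. lra. }
assert (HE : E / INR n < e / 2).
{ apply Rlt_div_l; [lra|]. assert (INR n0 < INR n) by (apply lt_INR; lia).
  assert (2 * E / e * (e / 2) < INR n * (e / 2)) by (apply Rmult_lt_compat_r; lra).
  replace (2 * E / e * (e / 2)) with E in H0 by (field; lra). lra. }
assert (b n / INR n <= b p / INR p + E / INR n).
{ apply Rle_div_l; [lra|]. replace ((b p / INR p + E / INR n) * INR n)
   with (INR n * (b p / INR p) + E) by (field; lra). exact Hup. }
unfold R_dist. apply Rabs_def1; lra.
Qed.

Lemma loxodromic_of_growth f y k : 0 < k ->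
  (forall n, INR n * k <= dist y (act (gpow f n) y)) -> loxodromic act f.
Proof.
intros k0 Hk. exists y. apply (fekete (fun n => dist y (act (gpow f n) y)) k k0); [|exact Hk].
intros n m. rewrite gpow_add, <- act_act.
pose proof (dist_tri X y (act (gpow f n) y) (act (gpow f n) (act (gpow f m) y))) as H.
rewrite dist_act in H. exact H.
Qed.


Lemma loxodromic_inv u : loxodromic act u -> loxodromic act (ginv u).
Proof.
intros (x0 & l & l0 & Hl). exists x0, l. split; [exact l0|].
intros e e0. destruct (Hl e e0) as [N HN]. exists N. intros n Hn.
rewrite gpow_inv, dist_inv. now apply HN.
Qed.

(** Arbitrarily late pairs of indices have product below [M]. Both sequences converge at infinity,
    so two uses of hyperbolicity carry the bound to all late pairs; an early point is within [E] of
    [y], which bounds the product directly. *)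
Lemma gp_bounded_of_not_same_boundary u v y :
  loxodromic act u -> loxodromic act v ->
  ~ same_boundary_point y (fun n => act (gpow u n) y) (fun n => act (gpow v n) y) ->
  exists C, 0 <= C /\ forall n m, gp y (act (gpow u n) y) (act (gpow v m) y) <= C.
Proof.
intros Hu Hv Hn.
apply not_all_ex_not in Hn. destruct Hn as [M HM].
assert (HM' : forall N, exists n m, (N <= n)%nat /\ (N <= m)%nat /\
   gp y (act (gpow u n) y) (act (gpow v m) y) < M).
{ intros N. apply NNPP. intros H. apply HM. exists N. intros n m Hn Hm.
  apply Rnot_lt_ge. intros Hlt. apply H. now exists n, m. }
destruct (loxodromic_gp_diverges u y (M + 2 * delta + 1) Hu) as [Nu HNu].
destruct (loxodromic_gp_diverges v y (M + 2 * delta + 1) Hv) as [Nv HNv].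
set (N := max Nu Nv).
destruct (HM' N) as (n0 & m0 & Hn0 & Hm0 & Hlt).
assert (M0 : 0 <= M) by (pose proof (gp_ge0 y (act (gpow u n0) y) (act (gpow v m0) y)); lra).
set (E := INR N * dist y (act u y) + INR N * dist y (act v y)).
assert (E1 : 0 <= INR N * dist y (act u y)) by (apply Rmult_le_pos; [apply pos_INR|apply dist_ge0]).
assert (E2 : 0 <= INR N * dist y (act v y)) by (apply Rmult_le_pos; [apply pos_INR|apply dist_ge0]).
exists (M + 2 * delta + E). split; [unfold E; lra|].
intros n m.
destruct (Nat.le_gt_cases N n) as [Hn|Hn].
2:{ assert (gp y (act (gpow u n) y) (act (gpow v m) y) <= INR N * dist y (act u y)); [|unfold E; lra].
  eapply Rle_trans; [apply gp_le_dist|]. eapply Rle_trans; [apply dist_gpow_le|].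
  apply Rmult_le_compat_r; [apply dist_ge0|]. apply le_INR. lia. }
destruct (Nat.le_gt_cases N m) as [Hm|Hm].
2:{ assert (gp y (act (gpow u n) y) (act (gpow v m) y) <= INR N * dist y (act v y)); [|unfold E; lra].
  rewrite gp_sym.
  eapply Rle_trans; [apply gp_le_dist|]. eapply Rle_trans; [apply dist_gpow_le|].
  apply Rmult_le_compat_r; [apply dist_ge0|]. apply le_INR. lia. }
specialize (HNu n0 n ltac:(lia) ltac:(lia)). specialize (HNv m m0 ltac:(lia) ltac:(lia)).
destruct (gp_hyp delta Xhyp y (act (gpow u n0) y) (act (gpow u n) y) (act (gpow v m0) y)); [lra|].
destruct (gp_hyp delta Xhyp y (act (gpow u n) y) (act (gpow v m) y) (act (gpow v m0) y)); unfold E; lra.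
Qed.

(** * Ping-pong and the Schottky family *)

(** The path through [v y], [y], [d y], [d v y] has small turns at [y] and [d y], and [d] is long,
    so [v y] and [d v y] diverge at [y]. [E] is paid for [s], for [t], and for moving the base point
    to [p y]. *)
Lemma ping_pong_separated u v y C E d m (p q s t : G) :
  gp y (act d y) (act v y) <= C -> gp y (act (ginv d) y) (act v y) <= C ->
  2 * C + delta < dist y (act d y) ->
  q = gmul p d -> dist y (act p y) <= E -> dist y (act s y) <= E -> dist y (act t y) <= E ->
  u = gmul (gmul p v) s -> m = gmul (gmul q v) t ->
  gp y (act u y) (act m y) <= C + delta + 3 * E.
Proof.
intros H1 H2 H3 -> HE1 HE2 HE3 -> ->.
set (a := gmul p v). set (b := gmul (gmul p d) v).
pose proof (gp_lip y (act (gmul a s) y) (act a y) (act (gmul b t) y)) as A1.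
pose proof (gp_lip y (act (gmul b t) y) (act b y) (act a y)) as A2.
rewrite dist_tail in A1, A2.
pose proof (gp_lip_base y (act p y) (act a y) (act b y)) as A3.
pose proof (gp_sym y (act a y) (act b y)). pose proof (gp_sym y (act a y) (act (gmul b t) y)).
assert (B : gp (act p y) (act a y) (act b y) <= C + delta); [|lra].
unfold a, b. rewrite <- (gmul_assoc _ p d v), <- !(act_act p), gp_act.
eapply (gp_extend_r delta Xhyp _ _ (act d y)).
- rewrite gp_sym. exact H1.
- rewrite <- (gp_act (ginv d)), !act_act, gmul_assoc, gmul_Vl, act1, gmul_1l. exact H2.
- lra.
Qed.

(* The initial powers [g^{iN}] separate the members, the final powers [g^{(r-i)N}] separate their
   inverses and make all members words of the same length in [g] and [h]. *)
Definition schottky_family (g h : G) (r N Q i : nat) : G :=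
  gmul (gmul (gpow g (i * N)) (gpow h Q)) (gpow g ((r - i) * N)).

(** [C] and [N] are fixed before [D]; only the exponent [Q] of [h] depends on [D]. Products of
    powers of [g] and [h] are bounded uniformly in the exponents, so the members become long without
    losing their separation. *)
Lemma schottky_exists g h y r :
  loxodromic act g -> loxodromic act h ->
  (forall u v, In u (g :: ginv g :: nil) -> In v (h :: ginv h :: nil) ->
    ~ same_boundary_point y (fun n => act (gpow u n) y) (fun n => act (gpow v n) y)) ->
  exists C N, 0 <= C /\ forall D, exists Q, forall i, (i <= r)%nat ->
    D <= dist y (act (schottky_family g h r N Q i) y) /\
    forall j, (i < j)%nat -> (j <= r)%nat ->
    gp y (act (schottky_family g h r N Q i) y) (act (schottky_family g h r N Q j) y) <= C /\
    gp y (act (ginv (schottky_family g h r N Q i)) y)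
         (act (ginv (schottky_family g h r N Q j)) y) <= C.
Proof.
intros Hg Hh Hne.
pose proof (loxodromic_inv g Hg) as Hg'. pose proof (loxodromic_inv h Hh) as Hh'.
destruct (gp_bounded_of_not_same_boundary g h y Hg Hh) as (C1 & C10 & HC1);
  [apply Hne; simpl; auto|].
destruct (gp_bounded_of_not_same_boundary (ginv g) h y Hg' Hh) as (C2 & C20 & HC2);
  [apply Hne; simpl; auto|].
destruct (gp_bounded_of_not_same_boundary g (ginv h) y Hg Hh') as (C3 & C30 & HC3);
  [apply Hne; simpl; auto|].
destruct (gp_bounded_of_not_same_boundary (ginv g) (ginv h) y Hg' Hh') as (C4 & C40 & HC4);
  [apply Hne; simpl; auto|].
set (C := C1 + C2 + C3 + C4).
(* Every positive power of [g^N1] moves [y] by more than [2 * C + delta], the length that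
   [ping_pong_separated] asks of [d]. *)
destruct (loxodromic_dist_diverges g y (2 * C + delta + 1) Hg) as [N HN].
set (N1 := S N).
set (E := INR (r * N1) * dist y (act g y)).
assert (E0 : 0 <= E) by (apply Rmult_le_pos; [apply pos_INR|apply dist_ge0]).
assert (HE : forall k, (k <= r)%nat -> dist y (act (gpow g (k * N1)) y) <= E).
{ intros k Hk. eapply Rle_trans; [apply dist_gpow_le|].
  apply Rmult_le_compat_r; [apply dist_ge0|]. apply le_INR. nia. }
assert (HE' : forall k, (k <= r)%nat -> dist y (act (gpow (ginv g) (k * N1)) y) <= E).
{ intros k Hk. rewrite gpow_inv, dist_inv. now apply HE. }
exists (C + delta + 3 * E), N1. split; [unfold C; lra|].
intros D.
destruct (loxodromic_dist_diverges h y (D + 2 * E) Hh) as [Q HQ].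
exists Q. intros i Hi. split.
{ unfold schottky_family. specialize (HQ Q (le_n Q)).
  set (p := gpow g (i * N1)). set (s := gpow g ((r - i) * N1)).
  pose proof (HE i Hi) as A1. pose proof (HE (r - i)%nat ltac:(lia)) as A2. fold p in A1. fold s in A2.
  set (a := gmul p (gpow h Q)).
  pose proof (dist_tri X y (act (gmul a s) y) (act a y)) as T1.
  pose proof (dist_tri X (act p y) y (act a y)) as T2.
  rewrite dist_tail in T1. rewrite (dist_sym X (act p y) y), (dist_sym X (act p y)) in T2.
  unfold a in T2. rewrite dist_tail in T2. fold a in T2. lra. }
intros j Hij Hj. split.
- eapply (ping_pong_separated _ (gpow h Q) y C E (gpow g ((j - i) * N1)) _
    (gpow g (i * N1)) (gpow g (j * N1))); [..|reflexivity|reflexivity].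
  + pose proof (HC1 ((j - i) * N1)%nat Q). unfold C. lra.
  + rewrite <- gpow_inv. pose proof (HC2 ((j - i) * N1)%nat Q). unfold C. lra.
  + specialize (HN ((j - i) * N1)%nat ltac:(nia)). lra.
  + rewrite <- gpow_add. f_equal. nia.
  + now apply HE.
  + apply HE. lia.
  + apply HE. lia.
(* The inverse of member [j] has the shorter initial power of [ginv g], so it now comes first. *)
- unfold schottky_family. rewrite gp_sym, !ginv_mul, <- !gpow_inv, !gmul_assoc.
  eapply (ping_pong_separated _ (gpow (ginv h) Q) y C E (gpow (ginv g) ((j - i) * N1)) _
    (gpow (ginv g) ((r - j) * N1)) (gpow (ginv g) ((r - i) * N1))); [..|reflexivity|reflexivity].
  + pose proof (HC4 ((j - i) * N1)%nat Q). unfold C. lra.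
  + rewrite gpow_inv, ginvK. pose proof (HC3 ((j - i) * N1)%nat Q). unfold C. lra.
  + specialize (HN ((j - i) * N1)%nat ltac:(nia)). rewrite gpow_inv, dist_inv. lra.
  + rewrite <- gpow_add. f_equal. nia.
  + apply HE'. lia.
  + now apply HE'.
  + now apply HE'.
Qed.


(** * Elements that nearly fix two points *)

Lemma stab_near K p q z c g :
  gp z p q <= c -> Stab act K p q g -> dist z (act g z) <= K + 2 * c + 2 * delta.
Proof.
intros Hz [H1 H2].
assert (A : forall u, dist u (act g u) <= K -> Rabs (dist u (act g z) - dist u z) <= K).
{ intros u Hu. apply Rabs_le.
  pose proof (dist_tri X u (act g u) (act g z)). pose proof (dist_tri X (act g u) u (act g z)).
  rewrite dist_act, (dist_sym X (act g u) u) in *. lra. }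
apply (dist_near_segment delta Xhyp p q); auto.
Qed.

(** By [stab_near] these elements move both ends of the translate by [b] of the segment from [y] to
    [h y] by at most [K']; conjugation by [b] therefore embeds them into the list [l]. *)
Lemma card_le_stab y (b h : G) K K' c p q l :
  (forall g, Stab act K' y (act h y) g -> In g l) -> K + 2 * c + 2 * delta <= K' ->
  gp (act b y) p q <= c -> gp (act (gmul b h) y) p q <= c ->
  card_le (Stab act K p q) (length l).
Proof.
intros Hl HK H1 H2 l' Hnd Hl'.
set (conj := fun g : G => gmul (gmul (ginv b) g) b).
rewrite <- (length_map conj). apply NoDup_incl_length.
- apply Injective_map_NoDup; [|exact Hnd].
  intros g g' Hg. apply gmul_cancel_r in Hg. now apply gmul_cancel_l in Hg.
- intros g' Hg'. apply in_map_iff in Hg'. destruct Hg' as (g & <- & Hg).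
  apply Hl. specialize (Hl' g Hg).
  pose proof (stab_near K p q _ c g H1 Hl') as A1. pose proof (stab_near K p q _ c g H2 Hl') as A2.
  unfold conj. split.
  + rewrite <- (dist_act b), !act_act, !gmul_assoc, gmul_Vr, gmul_1l, <- act_act. lra.
  + rewrite <- (dist_act b), !act_act, !gmul_assoc, gmul_Vr, gmul_1l.
    rewrite act_act, !gmul_assoc in A2. lra.
Qed.

(** * Axes and closest point projections *)

Section Axis.
Context (K1 C0 : R) (alpha : R -> X) (w : G).
Context (C00 : 0 <= C0).
Context (axis : is_axis act K1 w alpha).

Lemma axis_lb s t : Rabs (s - t) - K1 <= dist (alpha s) (alpha t).
Proof. apply axis. Qed.

Lemma axis_ub s t : dist (alpha s) (alpha t) <= Rabs (s - t) + K1.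
Proof. apply axis. Qed.

Lemma axis_K1 : 0 <= K1.
Proof. pose proof (axis_ub 0 0). rewrite (dist_refl X), Rminus_0_r, Rabs_R0 in H. lra. Qed.

Lemma axis_pow n t : exists s, act (gpow w n) (alpha t) = alpha s.
Proof.
induction n as [|n [s IH]].
- exists t. simpl. apply act1.
- simpl. rewrite <- act_act, IH. apply axis.
Qed.

Lemma axis_pow_inv n t : exists s, act (gpow (ginv w) n) (alpha t) = alpha s.
Proof.
induction n as [|n [s IH]].
- exists t. simpl. apply act1.
- simpl. rewrite <- act_act, IH. destruct axis as (_ & _ & H). destruct (H s) as [u Hu].
  exists u. rewrite <- Hu, act_act, gmul_Vl. apply act1.
Qed.

(** [alpha] need not be continuous, so intermediate points are chosen on the parameter line. *)
Lemma between_param s t r : 0 <= r <= Rabs (s - t) ->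
  exists u, Rabs (u - s) = r /\ Rabs (u - t) = Rabs (s - t) - r.
Proof.
intros Hr. destruct (Rle_lt_dec s t) as [H|H].
- rewrite (Rabs_left1 (s - t)) in * by lra. exists (s + r).
  rewrite (Rabs_pos_eq (s + r - s)), (Rabs_left1 (s + r - t)) by lra. lra.
- rewrite (Rabs_pos_eq (s - t)) in * by lra. exists (s - r).
  rewrite (Rabs_left1 (s - r - s)), (Rabs_pos_eq (s - r - t)) by lra. lra.
Qed.

Lemma axis_between s t u : Rabs (u - s) + Rabs (u - t) = Rabs (s - t) ->
  gp (alpha u) (alpha s) (alpha t) <= 2 * K1.
Proof.
intros H. unfold gp. pose proof axis_K1.
pose proof (axis_ub s u). pose proof (axis_ub t u). pose proof (axis_lb s t).
rewrite (Rabs_minus_sym s u), (Rabs_minus_sym t u) in *. lra.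
Qed.

(** Moving from [alpha t0] towards [alpha t] by about [g] comes closer to [y] by about [g], up to
    multiples of [K1] and [delta]; near minimality at [t0] bounds this gain by [C0]. *)
Lemma projection_gp y t0 t :
  (forall s, dist y (alpha t0) <= dist y (alpha s) + C0) ->
  gp (alpha t0) y (alpha t) <= C0 + 3 * K1 + 2 * delta.
Proof.
intros Hcl. set (g := gp (alpha t0) y (alpha t)). pose proof axis_K1.
destruct (Rle_lt_dec g K1) as [Hg|Hg]; [lra|].
assert (Hgd : g <= Rabs (t0 - t) + K1).
{ eapply Rle_trans; [|apply axis_ub]. unfold g. rewrite gp_sym. apply gp_le_dist. }
(* By [Hgd] a shift of [g - K1] stays between [t0] and [t]. *)
destruct (between_param t0 t (g - K1)) as (u & Hu1 & Hu2); [lra|].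
specialize (Hcl u).
pose proof (axis_ub u t) as A1. pose proof (axis_ub u t0) as A2. pose proof (axis_lb t0 t) as A3.
rewrite Hu1 in A2. rewrite Hu2 in A1.
assert (Eg : 2 * g = dist y (alpha t0) + dist (alpha t0) (alpha t) - dist y (alpha t)).
{ unfold g, gp. rewrite (dist_sym X (alpha t)). lra. }
pose proof (four_point delta Xhyp y (alpha u) (alpha t0) (alpha t)). lra.
Qed.

Lemma axis_near a b z c : gp z (alpha a) (alpha b) <= c ->
  exists t, dist z (alpha t) <= 2 * c + 2 * K1 + 2 * delta.
Proof.
intros Hz. pose proof axis_K1.
assert (c0 : 0 <= c) by (pose proof (gp_ge0 z (alpha a) (alpha b)); lra).
(* The axis point as far from [alpha a] as [z] is; the minimum keeps its parameter between [a] and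
   [b]. *)
set (r := Rmin (dist z (alpha a)) (Rabs (a - b))).
pose proof (Rabs_pos (a - b)). pose proof (dist_ge0 z (alpha a)).
assert (Hr : 0 <= r <= Rabs (a - b)) by (unfold r, Rmin; destruct (Rle_dec _ _); lra).
destruct (between_param a b r Hr) as (t & Ht1 & Ht2). exists t.
pose proof (axis_ub t a) as A1. pose proof (axis_ub t b) as A2. pose proof (axis_lb a b) as A3.
rewrite Ht1 in A1. rewrite Ht2 in A2.
unfold gp in Hz. rewrite (dist_sym X _ z), (dist_sym X (alpha b) z) in Hz.
pose proof (four_point delta Xhyp z (alpha t) (alpha a) (alpha b)) as F.
pose proof (dist_tri X (alpha a) (alpha b) z) as T.
pose proof (dist_ge0 z (alpha b)) as B0.
unfold r, Rmin in *. destruct (Rle_dec (dist z (alpha a)) (Rabs (a - b))) as [R1|R1]; [lra|].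
rewrite Rminus_diag in A2.
lra.
Qed.

(* Otherwise the segments from y, which is close to z, to x1 and to x2 both run through q1. *)
Lemma projections_separate (x1 x2 z y q1 q2 : X) c c' e :
  gp z x1 x2 <= c -> dist z y <= e ->
  gp q1 x1 y <= c' -> gp q2 x2 q1 <= c' -> gp q1 y q2 <= c' ->
  2 * c' + delta < dist q1 q2 ->
  gp z q1 q2 <= c + 2 * e + c' + 2 * delta.
Proof.
intros Hz He H1 H2 H3 Hd.
assert (B : gp q1 y x2 <= c' + delta).
{ eapply (gp_extend_r delta Xhyp y q1 q2 x2); [exact H3| |].
  - rewrite gp_sym. exact H2.
  - lra. }
pose proof (gp_lip_base y z x1 x2) as E1. rewrite (dist_sym X y z) in E1.
pose proof (gp_flip y q1 x1) as F1. pose proof (gp_flip y q1 x2) as F2.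
rewrite (gp_sym q1 y x1) in F1.
pose proof (gp_le_dist z q1 q2) as L. pose proof (dist_tri X z y q1) as T.
destruct (gp_hyp delta Xhyp y x1 q1 x2) as [Hh|Hh]; [rewrite gp_sym in Hh|]; lra.
Qed.

(** The displacement of [P] under [w^n] is at most [n * dist q (act w q) + 2 * D], so a displacement
    of [q] below [k] would contradict linear growth for large [n]. *)
Lemma translation_lb k P q : (forall n, INR n * k <= dist P (act (gpow w n) P)) ->
  k <= dist q (act w q).
Proof.
intros Hk. apply Rnot_lt_le. intros Hlt.
set (D := dist P q).
destruct (INR_unbounded (2 * D / (k - dist q (act w q)))) as [n Hn].
apply Rmult_lt_compat_r with (r := k - dist q (act w q)) in Hn; [|lra].
replace (2 * D / (k - dist q (act w q)) * (k - dist q (act w q))) with (2 * D) in Hn by (field; lra).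
specialize (Hk n). pose proof (dist_gpow_le w q n).
pose proof (dist_tri X P q (act (gpow w n) P)).
pose proof (dist_tri X q (act (gpow w n) q) (act (gpow w n) P)).
rewrite dist_act, (dist_sym X q P) in H1. unfold D in *. lra.
Qed.

(** First, [z] is near the axis, since the orbit of [P] stays at bounded distance from the axis and
    passes [z] in both directions. Then [q] and [w q], the projections of [x] and [w x], are at
    least [k] apart, which excludes that [z] lies far beyond either of them. *)
Lemma gp_axis_projection k P x z c q :
  0 < k -> (forall n, INR n * k <= dist P (act (gpow w n) P)) ->
  (forall n, gp z (act (gpow (ginv w) n) P) (act (gpow w (S n)) P) <= c) ->
  gp z x (act w x) <= c -> closest_point C0 x alpha q ->
  2 * (C0 + 3 * K1 + 2 * delta) + delta < k ->
  gp z q (act w q) <= 5 * c + C0 + 7 * K1 + 20 * delta.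
Proof.
intros k0 Hgrow Hzn Hzx (t0 & -> & Hcl) Hk.
set (q := alpha t0) in *. set (D := dist P q).
pose proof axis_K1 as K10.
assert (c0 : 0 <= c) by (pose proof (gp_ge0 z x (act w x)); lra).
assert (Hnear : exists t, dist z (alpha t) <= 2 * (c + 2 * delta) + 2 * K1 + 2 * delta).
(* For this [n] the translates of [P] by [w^(-n)] and [w^(n+1)] are so far from [z] that replacing
   them by the translates of [q] costs only [2 * delta] in the product at [z]. *)
{ destruct (INR_unbounded ((c + 2 * delta + D + dist z P) / k)) as [n Hn].
  apply Rmult_lt_compat_r with (r := k) in Hn; [|lra].
  replace ((c + 2 * delta + D + dist z P) / k * k) with (c + 2 * delta + D + dist z P) in Hn by (field; lra).
  destruct (axis_pow_inv n t0) as [a Ha]. destruct (axis_pow (S n) t0) as [b Hb].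
  apply (axis_near a b). rewrite <- Ha, <- Hb. fold q.
  set (p := act (gpow (ginv w) n) P). set (p' := act (gpow w (S n)) P).
  assert (Hfar : forall g, INR n * k <= dist P (act g P) ->
     c + 2 * delta < gp z (act g P) (act g q)).
  { intros g Hg. pose proof (gp_lip z (act g P) (act g q) (act g P)) as A.
    rewrite dist_act in A. fold D in A. rewrite (gp_sym z (act g q)) in A.
    assert (gp z (act g P) (act g P) = dist z (act g P)).
    { unfold gp. rewrite (dist_refl X), (dist_sym X z). lra. }
    pose proof (dist_tri X P z (act g P)). rewrite (dist_sym X P z) in *. lra. }
  assert (F1 : c + 2 * delta < gp z p (act (gpow (ginv w) n) q)).
  { apply Hfar. rewrite gpow_inv, dist_inv. apply Hgrow. }
  assert (F2 : c + 2 * delta < gp z p' (act (gpow w (S n)) q)).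
  { apply Hfar. specialize (Hgrow (S n)). rewrite S_INR in Hgrow. lra. }
  specialize (Hzn n). fold p p' in Hzn.
  destruct (gp_hyp delta Xhyp z p (act (gpow (ginv w) n) q) p'); [lra|].
  destruct (gp_hyp delta Xhyp z (act (gpow (ginv w) n) q) (act (gpow w (S n)) q) p') as [H0|H0];
    [|rewrite gp_sym in H0]; lra. }
destruct Hnear as [t Ht].
set (e := 2 * (c + 2 * delta) + 2 * K1 + 2 * delta) in *.
destruct axis as (_ & Hfw & Hbw). destruct (Hfw t0) as [t1 Ht1]. fold q in Ht1.
set (c' := C0 + 3 * K1 + 2 * delta) in *.
(* [w] maps the axis onto itself, so [w q] is a projection of [w x] with the same error [C0]. *)
assert (Hcl1 : forall s, dist (act w x) (alpha t1) <= dist (act w x) (alpha s) + C0).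
{ intros s. destruct (Hbw s) as [u Hu]. rewrite <- Ht1, <- Hu, !dist_act. apply Hcl. }
(* One of the three parameters lies between the other two. If it is [t], the bound is direct; if it
   is [t0] or [t1], [projections_separate] applies, with the two projections exchanged in the last
   case. *)
pose proof (translation_lb k P q Hgrow) as Htr. rewrite Ht1 in Htr |- *.
assert (Hb : Rabs (t - t0) + Rabs (t - t1) = Rabs (t0 - t1) \/
   Rabs (t0 - t) + Rabs (t0 - t1) = Rabs (t - t1) \/
   Rabs (t1 - t) + Rabs (t1 - t0) = Rabs (t - t0)).
{ unfold Rabs. repeat destruct (Rcase_abs _); lra. }
destruct Hb as [Hb|[Hb|Hb]]; apply axis_between in Hb.
- pose proof (gp_lip_base z (alpha t) q (alpha t1)). unfold e in *. fold q in Hb. lra.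
- pose proof (projections_separate x (act w x) z (alpha t) q (alpha t1) c c' e Hzx Ht) as A.
  eapply Rle_trans; [apply A|].
  + now apply projection_gp.
  + now apply projection_gp.
  + unfold q, c'. lra.
  + lra.
  + unfold e, c'. lra.
- pose proof (projections_separate (act w x) x z (alpha t) (alpha t1) q c c' e) as A.
  rewrite gp_sym. eapply Rle_trans; [apply A|].
  + now rewrite gp_sym.
  + exact Ht.
  + now apply projection_gp.
  + now apply projection_gp.
  + unfold q, c'. lra.
  + rewrite (dist_sym X). lra.
  + unfold e, c'. lra.
Qed.

End Axis.


(** * Words without backtracking *)

Lemma gp_near_trans (y z u v : X) : gp z y v <= gp z y u + gp u y v.
Proof.
unfold gp. pose proof (dist_tri X v u z). lra.
Qed.

Section GoodWord.
Context (x : X) (C D : R) (h : G).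

(* A word A s h s' N t B is conjugate to s h s' N t (B A). The two predicates say that neither
   the path from x to A s h s' N t B x nor the periodic path of s h s' N t (B A) backtracks at s, s', t:
   [outer_ok] collects the conditions that do not involve the inner word N,
   [inner_ok] those that do not involve the outer words A and B. *)
Definition outer_ok (A B s t : G) : Prop :=
  gp x (act (ginv A) x) (act s x) <= C /\
  gp x (act (ginv t) x) (act B x) <= C /\
  gp x (act (ginv (gmul (gmul t B) A)) x) (act s x) <= C /\
  gp x (act (ginv t) x) (act (gmul B A) x) <= C.

Definition inner_ok (s s' t N : G) : Prop :=
  gp x (act (ginv s) x) (act h x) <= C /\
  gp x (act (ginv (gmul s h)) x) (act s' x) <= C /\
  gp x (act (ginv s') x) (act N x) <= C /\
  gp x (act (ginv (gmul s' N)) x) (act t x) <= C.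

Lemma turn_r p s v c c' :
  gp x (act (ginv p) x) (act s x) <= c -> gp x (act (ginv s) x) (act v x) <= c' ->
  c + c' + delta < dist x (act s x) ->
  gp x (act (ginv p) x) (act (gmul s v) x) <= c + delta.
Proof.
intros H1 H2 H3. eapply (gp_extend_r delta Xhyp _ x (act s x)); [exact H1| |exact H3].
rewrite <- (gp_act (ginv s)), !act_act, gmul_assoc, gmul_Vl, act1, gmul_1l. exact H2.
Qed.

Lemma turn_l p s v c c' :
  gp x (act (ginv p) x) (act s x) <= c -> gp x (act (ginv s) x) (act v x) <= c' ->
  c + c' + delta < dist x (act s x) ->
  gp x (act (ginv (gmul p s)) x) (act v x) <= c' + delta.
Proof.
intros H1 H2 H3. rewrite gp_sym, <- (ginvK v). rewrite ginv_mul.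
eapply (turn_r (ginv v) (ginv s) (ginv p) c' c).
- rewrite ginvK, gp_sym. exact H2.
- rewrite ginvK, gp_sym. exact H1.
- rewrite dist_inv. lra.
Qed.

Lemma turn_lb s v : gp x (act (ginv s) x) (act v x) <= C ->
  dist x (act s x) - 2 * C <= dist x (act (gmul s v) x).
Proof. intros H. rewrite dist_mul. pose proof (dist_ge0 x (act v x)). lra. Qed.

(** [w] is conjugate by [A] to the cyclic word [f]. Each of its three factors [e1], [e2], [e3]
    begins with a Schottky word and is long whatever the lengths of [h], [N], [B] and [A], so the
    orbit of [f] has long steps and small turns. *)
Lemma good_word_geometry A B s s' t N w k :
  w = gmul (gmul (gmul (gmul (gmul (gmul A s) h) s') N) t) B ->
  outer_ok A B s t -> inner_ok s s' t N ->
  D <= dist x (act s x) -> D <= dist x (act s' x) -> D <= dist x (act t x) ->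
  10 * C + 20 * delta + k < D -> 0 < k ->
  exists P, (forall n, INR n * k <= dist P (act (gpow w n) P)) /\
  forall z, z = act (gmul A s) x \/ z = act (gmul (gmul A s) h) x ->
    gp z x (act w x) <= 5 * C + 20 * delta /\
    forall n, gp z (act (gpow (ginv w) n) P) (act (gpow w (S n)) P) <= 5 * C + 20 * delta.
Proof.
intros Hw (O1 & O2 & O3 & O4) (I1 & I2 & I3 & I4) Ds Ds' Dt HD k0.
assert (C00 : 0 <= C) by (pose proof (gp_ge0 x (act (ginv A) x) (act s x)); lra).
set (e1 := gmul s h). set (e2 := gmul s' N). set (e3 := gmul t (gmul B A)).
(* [e4] takes the place of [e3] on the path that stops at [w x]. *)
set (e4 := gmul t B). set (f := gmul e1 (gmul e2 e3)).
set (c := C + delta).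
assert (L1 := turn_lb _ _ I1). assert (L2 := turn_lb _ _ I3).
assert (L3 := turn_lb _ _ O4). fold e1 in L1. fold e2 in L2. fold e3 in L3.
assert (L4 := turn_lb _ _ O2). fold e4 in L4.
assert (Ha : gp x (act (ginv e3) x) (act e1 x) <= c).
{ apply (turn_r _ _ _ C C); [|exact I1|lra]. unfold e3. rewrite gmul_assoc. exact O3. }
assert (Ha' : gp x (act (ginv A) x) (act e1 x) <= c) by (apply (turn_r _ _ _ C C); [exact O1|exact I1|lra]).
assert (Hb : gp x (act (ginv e1) x) (act e2 x) <= c) by (apply (turn_r _ _ _ C C); [exact I2|exact I3|lra]).
assert (Hc : gp x (act (ginv e2) x) (act e3 x) <= c) by (apply (turn_r _ _ _ C C); [exact I4|exact O4|lra]).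
assert (Hc' : gp x (act (ginv e2) x) (act e4 x) <= c) by (apply (turn_r _ _ _ C C); [exact I4|exact O2|lra]).
assert (Hd : gp x (act (ginv e1) x) (act (gmul e2 e3) x) <= c + delta)
  by (apply (turn_r _ _ _ c c); [exact Hb|exact Hc|unfold c; lra]).
assert (Hd' : gp x (act (ginv e1) x) (act (gmul e2 e4) x) <= c + delta)
  by (apply (turn_r _ _ _ c c); [exact Hb|exact Hc'|unfold c; lra]).
assert (He : gp x (act (ginv e3) x) (act f x) <= c + delta)
  by (apply (turn_r _ _ _ c (c + delta)); [exact Ha|exact Hd|unfold c; lra]).
assert (Hf0 : gp x (act (ginv (gmul e1 e2)) x) (act e3 x) <= c + delta)
  by (apply (turn_l _ _ _ c c); [exact Hb|exact Hc|unfold c; lra]).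
assert (Hf : gp x (act (ginv f) x) (act f x) <= c + 2 * delta).
{ unfold f at 1. rewrite gmul_assoc.
  replace (c + 2 * delta) with (c + delta + delta) by lra.
  apply (turn_l _ _ _ (c + delta) (c + delta)); [exact Hf0|exact He|unfold c; lra]. }
assert (Lf : 3 * (D - 2 * C) - 4 * c - 2 * delta <= dist x (act f x)).
{ unfold f. rewrite dist_mul, (dist_mul e2 e3). lra. }
set (L := 3 * (D - 2 * C) - 4 * c - 2 * delta) in *.
assert (HcL : 2 * (c + 2 * delta) + 3 * delta < L) by (unfold L, c; lra).
assert (Hpow : forall n, gpow w n = gmul (gmul A (gpow f n)) (ginv A)).
{ intros n. rewrite <- gpow_conj. f_equal. rewrite Hw. unfold f, e1, e2, e3.
  rewrite !gmul_assoc, gmulK. reflexivity. }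
assert (Hpow' : forall n, gpow (ginv w) n = gmul (gmul A (gpow (ginv f) n)) (ginv A)).
{ intros n. rewrite !gpow_inv, Hpow, !ginv_mul, ginvK, gmul_assoc. reflexivity. }
exists (act A x). split.
{ intros n. rewrite Hpow, act_act, gmulKV, <- act_act, dist_act.
  eapply Rle_trans; [|apply (orbit_growth f x _ L Hf Lf HcL)].
  apply Rmult_le_compat_l; [apply pos_INR|]. unfold L, c. lra. }
assert (Q1 : gp (act e1 x) x (act f x) <= c + delta).
{ rewrite <- (gp_act (ginv e1)), !act_act. unfold f.
  rewrite gmul_assoc, !gmul_Vl, gmul_1l, act1. exact Hd. }
assert (Q1' : gp (act e1 x) x (act (gmul e1 (gmul e2 e4)) x) <= c + delta).
{ rewrite <- (gp_act (ginv e1)), !act_act.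
  rewrite gmul_assoc, !gmul_Vl, gmul_1l, act1. exact Hd'. }
assert (Q0 : gp (act s x) x (act e1 x) <= C).
{ rewrite <- (gp_act (ginv s)), !act_act. unfold e1.
  rewrite gmul_assoc, !gmul_Vl, gmul_1l, act1. exact I1. }
assert (Q2 : gp (act e1 x) (act (ginv A) x) (act (gmul e1 (gmul e2 e4)) x) <= c + 2 * delta).
{ replace (c + 2 * delta) with (c + delta + delta) by lra.
  eapply (gp_extend_l delta Xhyp _ x); [exact Ha'|exact Q1'|]. unfold c. lra. }
assert (Q3 : gp (act s x) (act (ginv A) x) (act e1 x) <= C + delta).
{ eapply (gp_extend_l delta Xhyp _ x); [exact O1|exact Q0|]. lra. }
(* Everything is moved by [ginv A], which takes [z] to [s x] or [s h x]. *)
assert (main : forall z', z' = act s x \/ z' = act e1 x ->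
  gp z' (act (ginv A) x) (act (gmul e1 (gmul e2 e4)) x) <= 5 * C + 20 * delta /\
  forall n, gp z' (act (gpow (ginv f) n) x) (act (gpow f (S n)) x) <= 5 * C + 20 * delta).
{ intros z' Hz'.
  assert (Z1 : gp z' x (act f x) <= C + c + delta).
  { destruct Hz' as [-> | ->]; [|lra].
    pose proof (gp_near_trans x (act s x) (act e1 x) (act f x)). lra. }
  split.
  - pose proof (gp_near_trans (act (ginv A) x) (act s x) (act e1 x) (act (gmul e1 (gmul e2 e4)) x)).
    destruct Hz' as [-> | ->]; unfold c in *; lra.
  (* [z'] is near the orbit segment from [x] to [f x]; [gp_near_trans] replaces the far points by
     [f x] and [x] at the price of the turns there. *)
  - intros n. pose proof (orbit_two_sided f x _ L Hf Lf HcL) as T.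
    pose proof (gp_near_trans (act (gpow (ginv f) n) x) z' (act f x) (act (gpow f (S n)) x)) as T1.
    pose proof (gp_near_trans (act f x) z' x (act (gpow (ginv f) n) x)) as T2.
    rewrite (gp_sym z' (act f x) x), (gp_sym z' (act f x)), (gp_sym x (act f x)) in T2.
    pose proof (T (S n) n) as T3.
    rewrite <- (gp_act f), !act_act in T3. simpl gpow in T3.
    rewrite gmul_assoc, gmul_Vr, gmul_1l in T3.
    pose proof (T n 1%nat) as T4. simpl gpow in T4. rewrite gmul_1r in T4.
    simpl gpow in T1 |- *. unfold c in *. lra. }
intros z Hz.
destruct (main (act (ginv A) z)) as [M1 M2].
{ destruct Hz as [-> | ->]; [left|right]; rewrite act_act, !gmul_assoc, gmul_Vl, gmul_1l; reflexivity. }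
split.
- rewrite <- (gp_act (ginv A)), (act_act _ w). rewrite Hw.
  replace (gmul (ginv A) _) with (gmul e1 (gmul e2 e4)); [exact M1|].
  unfold e1, e2, e4. rewrite !gmul_assoc, gmul_Vl, gmul_1l. reflexivity.
- intros n. rewrite <- (gp_act (ginv A)), Hpow, Hpow', !act_act, !gmul_assoc, gmul_Vl, !gmulKV, !gmul_1l.
  apply M2.
Qed.

End GoodWord.

End Action.

(** * Expectations along the walk *)

Definition ind (P : Prop) : R := if excluded_middle_informative P then 1 else 0.

Lemma ind_ge0 P : 0 <= ind P.
Proof. unfold ind. destruct (excluded_middle_informative P); lra. Qed.

Lemma ind_le1 P : ind P <= 1.
Proof. unfold ind. destruct (excluded_middle_informative P); lra. Qed.

Lemma ind_true (P : Prop) : P -> ind P = 1.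
Proof. unfold ind. destruct (excluded_middle_informative P); tauto. Qed.

Lemma ind_false (P : Prop) : ~ P -> ind P = 0.
Proof. unfold ind. destruct (excluded_middle_informative P); tauto. Qed.

Lemma Series_ge_sum (u : nat -> R) K : (forall k, 0 <= u k) -> ex_series u ->
  sum_f_R0 u K <= Series u.
Proof.
intros u0 Hu. rewrite (Series_incr_n u (S K)); [|lia|exact Hu].
simpl pred. rewrite <- (Rplus_0_r (sum_f_R0 u K)) at 1. apply Rplus_le_compat_l.
set (v := fun k => u (S K + k)%nat).
replace 0 with (Series (fun k => 0 * v k)) by (rewrite Series_scal_l; lra).
apply Series_le; [intros n; specialize (u0 (S K + n)%nat); unfold v; lra|].
now apply (ex_series_incr_n u (S K)).
Qed.

Section Walk.
Context {G : group} (a : nat -> G) (p : nat -> R).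
Context (prob : is_prob_seq p).

Lemma p_ge0 k : 0 <= p k.
Proof. apply prob. Qed.

Lemma p_series : is_series p 1.
Proof. apply is_series_Reals, prob. Qed.

Lemma p_sum_le1 K : sum_f_R0 p K <= 1.
Proof.
rewrite <- (is_series_unique _ _ p_series).
exact (Series_ge_sum p K p_ge0 (ex_intro _ 1 p_series)).
Qed.

Lemma p_le1 k : p k <= 1.
Proof.
pose proof (p_sum_le1 k) as A.
destruct k; simpl in A; [lra|]. pose proof (cond_pos_sum p k p_ge0). lra.
Qed.

(** The expectation of [F(w_n)], conditioned on the first letter as in [walk_prob]. [Series] is
    total, so convergence is settled only for functions that satisfy [bnd]. *)
Fixpoint Ex (n : nat) (F : G -> R) : R :=
  match n with
  | O => F gone
  | S m => Series (fun k => p k * Ex m (fun w => F (gmul (a k) w)))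
  end.

Definition bnd (M : R) {T : Type} (F : T -> R) : Prop := forall w, 0 <= F w <= M.

Lemma ex_series_weighted M (u : nat -> R) : bnd M u -> ex_series (fun k => p k * u k).
Proof.
intros Hu. apply (@ex_series_le R_AbsRing R_CompleteNormedModule _ (fun k => p k * M)).
- intros k. change norm with Rabs. specialize (Hu k). pose proof (p_ge0 k).
  rewrite Rabs_pos_eq by nra. nra.
- exists (1 * M). apply (is_series_scal_r M p 1 p_series).
Qed.

Lemma Series_const c : Series (fun k => p k * c) = c.
Proof.
rewrite Series_scal_r. rewrite (is_series_unique _ _ p_series). lra.
Qed.

Lemma Series_weighted_le M u v : bnd M u -> bnd M v -> (forall k, u k <= v k) ->
  Series (fun k => p k * u k) <= Series (fun k => p k * v k).
Proof.
intros Hu Hv Huv. apply Series_le; [|exact (ex_series_weighted M v Hv)].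
intros k. specialize (Hu k). specialize (Huv k). pose proof (p_ge0 k). nra.
Qed.

Lemma Series_weighted_bnd M u : bnd M u -> 0 <= Series (fun k => p k * u k) <= M.
Proof.
intros Hu. assert (M0 : 0 <= M) by (specialize (Hu O); lra).
split.
- rewrite <- (Series_const 0) at 1. apply (Series_weighted_le M); [intros k; lra|exact Hu|].
  intros k. apply Hu.
- rewrite <- (Series_const M) at 1. apply (Series_weighted_le M); [exact Hu|intros k; lra|].
  intros k. apply Hu.
Qed.

Lemma Ex_ext n : forall F F', (forall w, F w = F' w) -> Ex n F = Ex n F'.
Proof.
induction n as [|n IH]; intros F F' H; simpl; [apply H|].
apply Series_ext. intros k. f_equal. now apply IH.
Qed.

Lemma Ex_bnd n : forall M F, bnd M F -> 0 <= Ex n F <= M.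
Proof.
induction n as [|n IH]; intros M F H; simpl; [apply H|].
apply Series_weighted_bnd. intros k. apply IH. intros w. apply H.
Qed.

Lemma Ex_le n : forall M F F', bnd M F -> bnd M F' -> (forall w, F w <= F' w) -> Ex n F <= Ex n F'.
Proof.
induction n as [|n IH]; intros M F F' H H' Hle; simpl; [apply Hle|].
apply (Series_weighted_le M).
- intros k. apply Ex_bnd. intros w. apply H.
- intros k. apply Ex_bnd. intros w. apply H'.
- intros k. apply (IH M); intros w; [apply H|apply H'|apply Hle].
Qed.

Lemma Ex_plus n : forall M F F', bnd M F -> bnd M F' ->
  Ex n (fun w => F w + F' w) = Ex n F + Ex n F'.
Proof.
induction n as [|n IH]; intros M F F' H H'; simpl; [reflexivity|].
rewrite <- Series_plus.
- apply Series_ext. intros k. rewrite (IH M); [lra| |]; intros w; [apply H|apply H'].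
- apply (ex_series_weighted M). intros k. apply Ex_bnd. intros w. apply H.
- apply (ex_series_weighted M). intros k. apply Ex_bnd. intros w. apply H'.
Qed.

Lemma Ex_scal n c : forall F, Ex n (fun w => c * F w) = c * Ex n F.
Proof.
induction n as [|n IH]; intros F; simpl; [reflexivity|].
rewrite <- Series_scal_l. apply Series_ext. intros k. rewrite IH. lra.
Qed.

Lemma Ex_const n c : Ex n (fun _ => c) = c.
Proof.
induction n as [|n IH]; simpl; [reflexivity|].
transitivity (Series (fun k => p k * c)); [|apply Series_const].
apply Series_ext. intros k. now rewrite IH.
Qed.

Lemma Ex_sum n M (F : nat -> G -> R) K : (forall k, bnd M (F k)) ->
  Ex n (fun w => sum_f_R0 (fun k => F k w) K) = sum_f_R0 (fun k => Ex n (F k)) K.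
Proof.
intros H. induction K as [|K IH]; simpl; [reflexivity|].
rewrite <- IH. apply (Ex_plus n (INR (S (S K)) * M)).
- intros w. assert (0 <= M) by (specialize (H O w); lra).
  assert (0 <= sum_f_R0 (fun k => F k w) K <= INR (S K) * M); [|rewrite S_INR; lra].
  clear IH. induction K as [|K IH].
  + simpl. specialize (H O w). lra.
  + rewrite S_INR. specialize (H (S K) w). simpl sum_f_R0. lra.
- intros w. assert (0 <= M) by (specialize (H O w); lra).
  specialize (H (S K) w). rewrite S_INR. pose proof (pos_INR (S K)). nra.
Qed.

Lemma Ex_add n : forall m F, Ex (n + m) F = Ex n (fun u => Ex m (fun v => F (gmul u v))).
Proof.
induction n as [|n IH]; intros m F; simpl.
- apply Ex_ext. intros w. now rewrite gmul_1l.
- apply Series_ext. intros k. rewrite IH. f_equal. apply Ex_ext. intros u.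
  apply Ex_ext. intros v. now rewrite gmul_assoc.
Qed.

(** Dominated convergence: truncating the series at [K] changes it by at most [M * (1 - s)],
    uniformly in [w], which reduces the claim to finite sums. *)
Lemma Ex_series n M (F : nat -> G -> R) : (forall k, bnd M (F k)) ->
  Ex n (fun w => Series (fun k => p k * F k w)) = Series (fun k => p k * Ex n (F k)).
Proof.
intros H. symmetry. apply is_series_unique, is_series_Reals.
assert (M0 : 0 <= M) by (specialize (H O gone); lra).
assert (HpF : forall k, bnd M (fun w => p k * F k w)).
{ intros k w. specialize (H k w). pose proof (p_ge0 k).
  pose proof (p_le1 k). nra. }
intros e e0.
(* The divisor [M + 1] is positive even if [M = 0]. *)
destruct (proj2 prob (e / (M + 1))) as [N HN]; [apply Rdiv_lt_0_compat; lra|].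
exists N. intros K HK. specialize (HN K HK). unfold R_dist in *.
set (s := sum_f_R0 p K) in *.
assert (Hs : M * (1 - s) < e).
{ apply Rabs_def2 in HN. assert (1 - s < e / (M + 1)) by lra.
  apply (Rmult_lt_compat_l (M + 1)) in H0; [|lra].
  replace ((M + 1) * (e / (M + 1))) with e in H0 by (field; lra).
  pose proof (p_sum_le1 K : s <= 1). nra. }
assert (Hs1 : s <= 1) by apply p_sum_le1.
assert (E : sum_f_R0 (fun k => p k * Ex n (F k)) K =
  Ex n (fun w => sum_f_R0 (fun k => p k * F k w) K)).
{ rewrite (Ex_sum n M (fun k w => p k * F k w) K HpF).
  apply sum_eq. intros i _. symmetry. apply Ex_scal. }
rewrite E.
assert (Hw : forall w,
  sum_f_R0 (fun k => p k * F k w) K <= Series (fun k => p k * F k w) <=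
  sum_f_R0 (fun k => p k * F k w) K + M * (1 - s)).
{ intros w. split.
  - apply Series_ge_sum; [intros k; apply (HpF k w)|].
    apply (ex_series_weighted M). intros k. apply H.
  - assert (A : sum_f_R0 (fun k => p k * (M - F k w)) K <= Series (fun k => p k * (M - F k w))).
    { apply Series_ge_sum.
      - intros k. specialize (H k w). pose proof (p_ge0 k). nra.
      - apply (ex_series_weighted M). intros k. specialize (H k w). lra. }
    assert (B : Series (fun k => p k * (M - F k w)) = M - Series (fun k => p k * F k w)).
    { transitivity (Series (fun k => p k * M) - Series (fun k => p k * F k w)); [|now rewrite Series_const].
    rewrite <- Series_minus.
      - apply Series_ext. intros k. lra.
      - apply (ex_series_weighted M). intros k. lra.
      - apply (ex_series_weighted M). intros k. apply H. }
    assert (C : sum_f_R0 (fun k => p k * (M - F k w)) K =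
       M * s - sum_f_R0 (fun k => p k * F k w) K).
    { unfold s. rewrite scal_sum, <- minus_sum. apply sum_eq. intros; lra. }
    lra. }
assert (Bs : bnd M (fun w => Series (fun k => p k * F k w))).
{ intros w. apply Series_weighted_bnd. intros k. apply H. }
assert (Bf : bnd M (fun w => sum_f_R0 (fun k => p k * F k w) K)).
{ intros w. specialize (Hw w). specialize (Bs w). simpl in Bs. split; [|lra].
  apply cond_pos_sum. intros k. apply (HpF k w). }
assert (Bf' : bnd (M + M * (1 - s)) (fun w => sum_f_R0 (fun k => p k * F k w) K + M * (1 - s))).
{ intros w. specialize (Bf w). simpl in Bf. nra. }
assert (L1 : Ex n (fun w => sum_f_R0 (fun k => p k * F k w) K) <=
   Ex n (fun w => Series (fun k => p k * F k w))).
{ apply (Ex_le n M); auto. intros w. apply Hw. }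
assert (L2 : Ex n (fun w => Series (fun k => p k * F k w)) <=
  Ex n (fun w => sum_f_R0 (fun k => p k * F k w) K) + M * (1 - s)).
{ rewrite <- (Ex_const n (M * (1 - s))), <- (Ex_plus n (M + M * (1 - s))).
  - apply (Ex_le n (M + M * (1 - s))); auto.
    + intros w. specialize (Bs w). simpl in Bs. nra.
    + intros w. apply Hw.
  - intros w. specialize (Bf w). simpl in Bf. nra.
  - intros w. nra. }
apply Rabs_def1; lra.
Qed.

(** Fubini for independent words; it allows the last letters of the walk to be drawn before the
    middle ones. *)
Lemma Ex_swap n m : forall M (F : G -> G -> R), (forall w, bnd M (F w)) ->
  Ex n (fun w => Ex m (F w)) = Ex m (fun r => Ex n (fun w => F w r)).
Proof.
induction m as [|m IH]; intros M F H; simpl; [reflexivity|].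
rewrite (Ex_series n M (fun k w => Ex m (fun r => F w (gmul (a k) r)))).
- apply Series_ext. intros k. f_equal. apply (IH M (fun w r => F w (gmul (a k) r))).
  intros w r. apply H.
- intros k w. apply Ex_bnd. intros r. apply H.
Qed.

Lemma walk_prob_Ex n : forall E : G -> Prop, walk_prob a p n E (Ex n (fun w => ind (E w))).
Proof.
induction n as [|n IH]; intros E.
- simpl. unfold ind. destruct (excluded_middle_informative (E gone)); now constructor.
- simpl. apply (wpS a p n E (fun k => Ex n (fun w => ind (E (gmul (a k) w))))).
  + intros k. apply IH.
  + apply is_series_Reals, Series_correct, (ex_series_weighted 1).
    intros k. apply Ex_bnd. intros w. split; [apply ind_ge0|apply ind_le1].
Qed.

(* [w_m = g] has probability at least [q]; as an inequality between expectations this composes. *)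
Definition reach (m : nat) (q : R) (g : G) : Prop :=
  0 < q <= 1 /\ forall F M, bnd M F -> Ex m F <= q * F g + (1 - q) * M.

Lemma reach1 : reach 0 1 gone.
Proof. split; [lra|]. intros F M H. simpl. lra. Qed.

Lemma reach_gen k : 0 < p k -> reach 1 (p k) (a k).
Proof.
intros Hk.
split; [pose proof (p_le1 k); lra|]. intros F M H.
assert (E : Ex 1 F = Series (fun j => p j * F (a j))).
{ simpl. apply Series_ext. intros j. now rewrite gmul_1r. }
rewrite E.
(* The series of the nonnegative [M - F] is at least its [k]-th term. *)
pose proof (Series_ge_sum (fun j => p j * (M - F (a j))) k) as A.
assert (B : Series (fun j => p j * (M - F (a j))) = M - Series (fun j => p j * F (a j))).
{ transitivity (Series (fun k => p k * M) - Series (fun j => p j * F (a j))); [|now rewrite Series_const].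
    rewrite <- Series_minus.
  - apply Series_ext. intros j. lra.
  - apply (ex_series_weighted M). intros j. specialize (H gone). lra.
  - apply (ex_series_weighted M). intros j. apply H. }
assert (C : p k * (M - F (a k)) <= sum_f_R0 (fun j => p j * (M - F (a j))) k).
{ assert (P : forall j, 0 <= p j * (M - F (a j))).
  { intros j. specialize (H (a j)). pose proof (p_ge0 j). nra. }
  destruct k; simpl; [lra|]. pose proof (cond_pos_sum _ k P). simpl in H0. lra. }
assert (D : sum_f_R0 (fun j => p j * (M - F (a j))) k <= Series (fun j => p j * (M - F (a j)))).
{ apply A.
  - intros j. specialize (H (a j)). pose proof (p_ge0 j). nra.
  - apply (ex_series_weighted M). intros j. specialize (H (a j)). lra. }
lra.
Qed.

Lemma reach_mul m m' q q' g g' : reach m q g -> reach m' q' g' -> reach (m + m') (q * q') (gmul g g').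
Proof.
intros [Hq H] [Hq' H']. split; [nra|]. intros F M HF.
rewrite Ex_add.
eapply Rle_trans.
- apply (H _ M). intros u. apply Ex_bnd. intros v. apply HF.
- pose proof (H' (fun v => F (gmul g v)) M ltac:(intros v; apply HF)) as A. simpl in A. nra.
Qed.

Lemma reach_pow m q g n : reach m q g -> reach (n * m) (q ^ n) (gpow g n).
Proof.
intros H. induction n as [|n IH]; simpl; [apply reach1|now apply reach_mul].
Qed.

Lemma reach_semigroup g : in_semigroup a p g -> exists m q, reach m q g.
Proof.
induction 1 as [k Hk|g h _ (m & q & Hg) _ (m' & q' & Hh)].
- exists 1%nat, (p k). now apply reach_gen.
- exists (m + m')%nat, (q * q'). now apply reach_mul.
Qed.

End Walk.

(** * Nested averages *)

(** The mean over the indices 0 to 63 of the Schottky family. With 64 members, four conditions that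
    each fail for at most one index leave a bad proportion of at most 1/16. *)
Definition avg (u : nat -> R) : R := / 64 * sum_f_R0 u 63.

Lemma avg_ext u v : (forall i, u i = v i) -> avg u = avg v.
Proof. intros H. unfold avg. f_equal. apply sum_eq. intros i _. apply H. Qed.

Lemma avg_le u v : (forall i, u i <= v i) -> avg u <= avg v.
Proof.
intros H. unfold avg. apply Rmult_le_compat_l; [lra|]. apply sum_Rle. intros i _. apply H.
Qed.

Lemma avg_const c : avg (fun _ => c) = c.
Proof. unfold avg. rewrite sum_cte. replace (INR 64) with 64 by (simpl; lra). field. Qed.

Lemma avg_plus u v : avg (fun i => u i + v i) = avg u + avg v.
Proof. unfold avg. rewrite sum_plus. lra. Qed.

Lemma avg_scal c u : avg (fun i => c * u i) = c * avg u.
Proof.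
unfold avg. replace (c * (/ 64 * sum_f_R0 u 63)) with (/ 64 * (c * sum_f_R0 u 63)) by ring.
rewrite (scal_sum u 63 c). f_equal. apply sum_eq. intros. ring.
Qed.

Lemma avg_swap (u : nat -> nat -> R) :
  avg (fun i => avg (fun j => u i j)) = avg (fun j => avg (fun i => u i j)).
Proof.
assert (H : forall K, sum_f_R0 (fun i => avg (fun j => u i j)) K =
  avg (fun j => sum_f_R0 (fun i => u i j) K)).
{ induction K as [|K IH]; simpl; [reflexivity|]. now rewrite IH, avg_plus. }
unfold avg at 1. rewrite H, <- avg_scal. reflexivity.
Qed.

Lemma avg_ind_le (P : nat -> Prop) :
  (forall i j, (i < j)%nat -> (j <= 63)%nat -> ~ (P i /\ P j)) -> avg (fun i => ind (P i)) <= / 64.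
Proof.
intros H.
assert (A : forall K, (K <= 63)%nat -> sum_f_R0 (fun i => ind (P i)) K <= 1 /\
  ((forall i, (i <= K)%nat -> ~ P i) -> sum_f_R0 (fun i => ind (P i)) K = 0)).
{ induction K as [|K IH]; intros HK; simpl.
  - split; [apply ind_le1|]. intros Hn. apply ind_false. now apply Hn.
  - destruct (IH ltac:(lia)) as [I1 I2]. split.
    + destruct (classic (P (S K))) as [HP|HP].
      * rewrite I2; [pose proof (ind_le1 (P (S K))); lra|].
        intros i Hi Hpi. apply (H i (S K)); [lia|lia|now split].
      * rewrite (ind_false _ HP). lra.
    + intros Hn. rewrite I2, (ind_false (P (S K))); [lra| |].
      * apply Hn. lia.
      * intros i Hi. apply Hn. lia. }
unfold avg. destruct (A 63%nat (le_n _)) as [A1 _]. lra.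
Qed.

Definition avg3 (u : nat -> nat -> nat -> R) : R := avg (fun i => avg (fun j => avg (fun k => u i j k))).

Lemma avg3_ext u v : (forall i j k, u i j k = v i j k) -> avg3 u = avg3 v.
Proof. intros H. do 3 (apply avg_ext; intros ?). apply H. Qed.

Lemma avg3_le u v : (forall i j k, u i j k <= v i j k) -> avg3 u <= avg3 v.
Proof. intros H. do 3 (apply avg_le; intros ?). apply H. Qed.

Lemma avg3_const c : avg3 (fun _ _ _ => c) = c.
Proof. unfold avg3. now rewrite !avg_const. Qed.

Lemma avg3_plus u v : avg3 (fun i j k => u i j k + v i j k) = avg3 u + avg3 v.
Proof.
unfold avg3. rewrite <- avg_plus. apply avg_ext. intros i. rewrite <- avg_plus.
apply avg_ext. intros j. apply avg_plus.
Qed.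

Lemma avg3_scal c u : avg3 (fun i j k => c * u i j k) = c * avg3 u.
Proof.
unfold avg3. rewrite <- avg_scal. apply avg_ext. intros i. rewrite <- avg_scal.
apply avg_ext. intros j. apply avg_scal.
Qed.

Lemma avg3_avg (u : nat -> nat -> nat -> nat -> R) :
  avg (fun l => avg3 (u l)) = avg3 (fun i j k => avg (fun l => u l i j k)).
Proof.
unfold avg3. rewrite avg_swap. apply avg_ext. intros i. rewrite avg_swap.
apply avg_ext. intros j. apply avg_swap.
Qed.

Lemma avg3_swap (u : nat -> nat -> nat -> nat -> nat -> nat -> R) :
  avg3 (fun i j k => avg3 (u i j k)) = avg3 (fun i' j' k' => avg3 (fun i j k => u i j k i' j' k')).
Proof.
unfold avg3 at 1.
transitivity (avg (fun i => avg (fun j => avg3 (fun i' j' k' => avg (fun k => u i j k i' j' k'))))).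
{ do 2 (apply avg_ext; intros ?). apply avg3_avg. }
transitivity (avg (fun i => avg3 (fun i' j' k' => avg (fun j => avg (fun k => u i j k i' j' k'))))).
{ apply avg_ext; intros ?. apply avg3_avg. }
apply avg3_avg.
Qed.

Notation triple := (nat * nat * nat)%type.

Fixpoint avgL (n : nat) (u : list triple -> R) : R :=
  match n with
  | O => u nil
  | S m => avg3 (fun i j k => avgL m (fun cs => u ((i, j, k) :: cs)))
  end.

Lemma avgL_le n : forall u v, (forall cs, length cs = n -> u cs <= v cs) -> avgL n u <= avgL n v.
Proof.
induction n as [|n IH]; intros u v H; simpl; [now apply H|].
apply avg3_le. intros i j k. apply IH. intros cs Hcs. apply H. simpl. now rewrite Hcs.
Qed.

Lemma avgL_plus n : forall u v, avgL n (fun cs => u cs + v cs) = avgL n u + avgL n v.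
Proof.
induction n as [|n IH]; intros u v; simpl; [reflexivity|].
rewrite <- avg3_plus. apply avg3_ext. intros i j k. apply IH.
Qed.

Lemma avgL_scal n c : forall u, avgL n (fun cs => c * u cs) = c * avgL n u.
Proof.
induction n as [|n IH]; intros u; simpl; [reflexivity|].
rewrite <- avg3_scal. apply avg3_ext. intros i j k. apply IH.
Qed.

Lemma avgL_avg3 n : forall (u : list triple -> nat -> nat -> nat -> R),
  avgL n (fun cs => avg3 (u cs)) = avg3 (fun i j k => avgL n (fun cs => u cs i j k)).
Proof.
induction n as [|n IH]; intros u; simpl; [reflexivity|].
rewrite avg3_swap. apply avg3_ext. intros i j k. apply (IH (fun cs => u ((i, j, k) :: cs))).
Qed.

(** * Words with nested Schottky pairs *)

Section Nested.
Context {G : group} (f : nat -> G) (h : G).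
Implicit Types (vs : list (G * G)) (cs : list triple).

Definition block (i j k : nat) (v : G) : G := gmul (gmul (gmul (gmul (f i) h) (f j)) v) (f k).

Fixpoint nested_word vs cs (c : G) : G :=
  match vs, cs with
  | (l, r) :: vs', (i, j, k) :: cs' => gmul (gmul l (block i j k (nested_word vs' cs' c))) r
  | _, _ => c
  end.

(* Conditioned on which pairs (i-th block from the left, i-th block from the right) come from the
   Schottky family, all other letters [vs] and [c] are arbitrary. *)
Definition nested_bounded (B : R) (F : G -> R) : Prop :=
  forall vs c, avgL (length vs) (fun cs => F (nested_word vs cs c)) <= B * (1 / 2) ^ length vs.

(** The outer letters are absorbed into the first pair, or into [c] if there is none. *)
Lemma nested_bounded_conj B F l r : nested_bounded B F ->
  nested_bounded B (fun w => F (gmul (gmul l w) r)).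
Proof.
intros H [|[l' r'] vs] c.
- apply (H nil (gmul (gmul l c) r)).
- eapply Rle_trans; [|apply (H ((gmul l l', gmul r' r) :: vs) c)].
  apply avgL_le. intros [|[[i j] k] cs] Hcs; [discriminate|]. simpl.
  rewrite !gmul_assoc. lra.
Qed.

(** The averaged block is the outermost level of a longer word with trivial outer letters, and so
    uses up one factor 1/2. *)
Lemma nested_bounded_avg B F : nested_bounded B F ->
  nested_bounded (B / 2) (fun w => avg3 (fun i j k => F (block i j k w))).
Proof.
intros H vs c. rewrite avgL_avg3.
eapply Rle_trans; [|eapply Rle_trans; [apply (H ((gone, gone) :: vs) c)|]].
- simpl. apply avg3_le. intros i j k. apply avgL_le. intros cs _.
  rewrite gmul_1l, gmul_1r. lra.
- simpl. lra.
Qed.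

(** * From nested averages to the walk *)

Section Decay.
Context (a : nat -> G) (p : nat -> R) (m1 m2 : nat) (q1 q2 : R).
Context (prob : is_prob_seq p).
Context (reach_l : forall i j, reach a p m1 q1 (gmul (gmul (f i) h) (f j))).
Context (reach_r : forall k, reach a p m2 q2 (f k)).

Lemma Ex_avg n M (u : nat -> G -> R) : (forall i, bnd M (u i)) ->
  Ex a p n (fun w => avg (fun i => u i w)) = avg (fun i => Ex a p n (u i)).
Proof.
intros H. unfold avg. rewrite Ex_scal. f_equal. now apply (Ex_sum a p prob n M).
Qed.

Lemma avg_bnd M u : bnd M u -> 0 <= avg u <= M.
Proof.
intros H. split; [rewrite <- (avg_const 0)|rewrite <- (avg_const M)]; apply avg_le; apply H.
Qed.

Lemma Ex_avg3 n M (u : nat -> nat -> nat -> G -> R) : (forall i j k, bnd M (u i j k)) ->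
  Ex a p n (fun w => avg3 (fun i j k => u i j k w)) = avg3 (fun i j k => Ex a p n (u i j k)).
Proof.
intros H. unfold avg3.
rewrite (Ex_avg n M (fun i w => avg (fun j => avg (fun k => u i j k w)))).
- apply avg_ext. intros i. rewrite (Ex_avg n M (fun j w => avg (fun k => u i j k w))).
  + apply avg_ext. intros j. now apply (Ex_avg n M).
  + intros j w. apply avg_bnd. intros k. apply H.
- intros i w. apply avg_bnd. intros j. apply avg_bnd. intros k. apply H.
Qed.

(** Induction on the number of pairs, drawing the first [m1] and last [m2] letters. With weight
    [q1 * q2] they form a random block, after which the constant is [B / 2]; otherwise the induction
    bound holds for any outer letters. The factor is [q1 * q2 / 2 + (1 - q1 * q2)]. *)
Lemma Ex_decay T : forall n F B, (forall w, 0 <= F w) -> nested_bounded B F ->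
  ((m1 + m2) * T <= n)%nat -> Ex a p n F <= B * (1 - q1 * q2 / 2) ^ T.
Proof.
destruct (reach_l 0%nat 0%nat) as [Hq1 _]. destruct (reach_r 0%nat) as [Hq2 _].
induction T as [|T IH]; intros n F B F0 HF Hn.
{ simpl. assert (HB : bnd B F).
  { intros w. split; [apply F0|]. pose proof (HF nil w) as A. simpl in A. lra. }
  pose proof (Ex_bnd a p prob n B F HB). lra. }
assert (HB : bnd B F).
{ intros w. split; [apply F0|]. pose proof (HF nil w) as A. simpl in A. lra. }
set (q := 1 - q1 * q2 / 2) in *.
set (n' := (n - m1 - m2)%nat).
replace n with (m1 + (n' + m2))%nat by (unfold n'; nia).
assert (Hn' : ((m1 + m2) * T <= n')%nat) by (unfold n'; nia).
set (M := B * q ^ T).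
set (Phi := fun l => Ex a p (n' + m2) (fun w => F (gmul l w))).
assert (HPhi : bnd M Phi).
{ intros l. unfold Phi, M. split.
  - apply (Ex_bnd a p prob _ B). intros w. apply HB.
  - rewrite (Ex_ext a p _ _ (fun w => F (gmul (gmul l w) gone))) by (intros w; now rewrite gmul_1r).
    apply IH; [intros w; apply F0|now apply nested_bounded_conj|lia]. }
assert (HPsi : forall b, bnd M (fun r => Ex a p n' (fun w => F (gmul (gmul b w) r)))).
{ intros b r. split.
  - apply (Ex_bnd a p prob _ B). intros w. apply HB.
  - apply IH; [intros w; apply F0|now apply nested_bounded_conj|lia]. }
assert (step : forall i j k, Ex a p (m1 + (n' + m2)) F <=
  q1 * q2 * Ex a p n' (fun w => F (block i j k w)) + (1 - q1 * q2) * M).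
{ intros i j k. rewrite (Ex_add a p). fold Phi.
  eapply Rle_trans; [apply (proj2 (reach_l i j) _ M HPhi)|].
  set (b := gmul (gmul (f i) h) (f j)).
  assert (E : Phi b = Ex a p m2 (fun r => Ex a p n' (fun w => F (gmul (gmul b w) r)))).
  { unfold Phi. rewrite (Ex_add a p), <- (Ex_swap a p prob n' m2 B (fun w r => F (gmul (gmul b w) r))).
    - apply Ex_ext. intros w. apply Ex_ext. intros r. now rewrite gmul_assoc.
    - intros w r. apply HB. }
  pose proof (proj2 (reach_r k) _ M (HPsi b)) as A. rewrite <- E in A.
  change (fun w => F (block i j k w)) with (fun w => F (gmul (gmul b w) (f k))).
  cbv beta in A. nra. }
(* The left side and the weights do not depend on the triple, so [step] may be averaged over all
   triples. *)
rewrite <- (avg3_const (Ex a p (m1 + (n' + m2)) F)).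
eapply Rle_trans; [apply avg3_le; exact step|].
rewrite avg3_plus, avg3_const, avg3_scal, <- (Ex_avg3 n' B).
2:{ intros i j k w. apply HB. }
assert (A : Ex a p n' (fun w => avg3 (fun i j k => F (block i j k w))) <= B / 2 * q ^ T).
{ apply IH; [|now apply nested_bounded_avg|exact Hn'].
  intros w. rewrite <- (avg3_const 0). apply avg3_le. intros; apply F0. }
assert (0 < q1 * q2) by nra.
simpl. unfold M. apply Rmult_le_compat_l with (r := q1 * q2) in A; [|lra].
replace (B * (q * q ^ T)) with (q1 * q2 * (B / 2 * q ^ T) + (1 - q1 * q2) * (B * q ^ T))
  by (unfold q; field). lra.
Qed.

End Decay.

(** * Failure at every level *)

Section Failure.
Context (ob : G -> G -> nat -> nat -> Prop) (ib : nat -> nat -> nat -> G -> Prop).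

Definition good (w : G) : Prop :=
  exists A B i j k N, ob A B i k /\ ib i j k N /\ w = gmul (gmul A (block i j k N)) B.

Context (outer_rare : forall A B, avg3 (fun i j k => ind (~ ob A B i k)) <= / 16).
Context (inner_rare : forall N, avg3 (fun i j k => ind (~ ib i j k N)) <= / 16).

(* If no good decomposition exists then every level is bad for [ob] or for [ib], so the product of
   the two weights is at least 16^n and, by AM-GM, their sum is at least 2 * 4^n. The mean of each
   weight is at most 2^n. *)
Fixpoint outer_weight (A B : G) vs cs : R :=
  match vs, cs with
  | (l, r) :: vs', (i, j, k) :: cs' =>
      (1 + 15 * ind (~ ob (gmul A l) (gmul r B) i k)) *
      outer_weight (gmul (gmul (gmul (gmul A l) (f i)) h) (f j)) (gmul (f k) (gmul r B)) vs' cs'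
  | _, _ => 1
  end.

Fixpoint inner_weight vs cs (c : G) : R :=
  match vs, cs with
  | (l, r) :: vs', (i, j, k) :: cs' =>
      (1 + 15 * ind (~ ib i j k (nested_word vs' cs' c))) * inner_weight vs' cs' c
  | _, _ => 1
  end.

Lemma outer_weight_ge0 vs : forall A B cs, 0 <= outer_weight A B vs cs.
Proof.
induction vs as [|[l r] vs IH]; intros A B [|[[i j] k] cs]; simpl; try lra.
apply Rmult_le_pos; [|apply IH]. pose proof (ind_ge0 (~ ob (gmul A l) (gmul r B) i k)). lra.
Qed.

Lemma inner_weight_ge0 vs c : forall cs, 0 <= inner_weight vs cs c.
Proof.
induction vs as [|[l r] vs IH]; intros [|[[i j] k] cs]; simpl; try lra.
apply Rmult_le_pos; [|apply IH]. pose proof (ind_ge0 (~ ib i j k (nested_word vs cs c))). lra.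
Qed.

Lemma weight_of_failure vs c : forall A B cs, length cs = length vs ->
  ~ good (gmul (gmul A (nested_word vs cs c)) B) ->
  16 ^ length vs <= outer_weight A B vs cs * inner_weight vs cs c.
Proof.
induction vs as [|[l r] vs IH]; intros A B [|[[i j] k] cs] Hcs Hf; simpl; try discriminate; [lra|].
injection Hcs as Hcs. simpl in Hf.
set (N := nested_word vs cs c) in *.
set (A' := gmul (gmul (gmul (gmul A l) (f i)) h) (f j)). set (B' := gmul (f k) (gmul r B)).
(* The outermost level is absorbed into the outer words, so failure passes to the remaining
   levels. *)
assert (E : gmul (gmul A (gmul (gmul l (block i j k N)) r)) B = gmul (gmul A' N) B').
{ unfold A', B', block. now rewrite !gmul_assoc. }
rewrite E in Hf. specialize (IH A' B' cs Hcs Hf).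
pose proof (outer_weight_ge0 vs A' B' cs). pose proof (inner_weight_ge0 vs c cs).
set (O := outer_weight A' B' vs cs) in *. set (I := inner_weight vs cs c) in *.
assert (W : 16 <= (1 + 15 * ind (~ ob (gmul A l) (gmul r B) i k)) * (1 + 15 * ind (~ ib i j k N))).
{ pose proof (ind_ge0 (~ ob (gmul A l) (gmul r B) i k)). pose proof (ind_ge0 (~ ib i j k N)).
  destruct (classic (ob (gmul A l) (gmul r B) i k)) as [Ho|Ho].
  - destruct (classic (ib i j k N)) as [Hi|Hi].
    + exfalso. apply Hf. exists (gmul A l), (gmul r B), i, j, k, N. repeat split; auto.
      unfold A', B', block. now rewrite !gmul_assoc.
    + rewrite (ind_true (~ ib i j k N)) by exact Hi. nra.
  - rewrite (ind_true (~ ob (gmul A l) (gmul r B) i k)) by exact Ho. nra. }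
assert (0 <= O * I) by (now apply Rmult_le_pos).
replace (_ * O * (_ * I)) with ((1 + 15 * ind (~ ob (gmul A l) (gmul r B) i k)) *
   (1 + 15 * ind (~ ib i j k N)) * (O * I)) by ring.
pose proof (pow_lt 16 (length vs) ltac:(lra)).
apply Rmult_le_compat; lra.
Qed.

(** The deeper levels are averaged first, with a bound uniform in their outer words; the remaining
    factor has mean at most [1 + 15 / 16] by [outer_rare]. *)
Lemma avg_outer_weight vs : forall A B, avgL (length vs) (outer_weight A B vs) <= 2 ^ length vs.
Proof.
induction vs as [|[l r] vs IH]; intros A B; simpl; [lra|].
eapply Rle_trans.
- apply avg3_le. intros i j k. rewrite avgL_scal. apply Rmult_le_compat_l; [|apply IH].
  pose proof (ind_ge0 (~ ob (gmul A l) (gmul r B) i k)). lra.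
- rewrite (avg3_ext _ (fun i j k => 2 ^ length vs * (1 + 15 * ind (~ ob (gmul A l) (gmul r B) i k))))
    by (intros; ring).
  rewrite avg3_scal, avg3_plus, avg3_const, avg3_scal.
  specialize (outer_rare (gmul A l) (gmul r B)).
  pose proof (pow_lt 2 (length vs) ltac:(lra)). nra.
Qed.

(** The outermost factor depends on all deeper triples, so [avgL_avg3] exchanges the averages: the
    outermost triple is averaged first, with the inner word fixed. *)
Lemma avg_inner_weight vs c : avgL (length vs) (fun cs => inner_weight vs cs c) <= 2 ^ length vs.
Proof.
induction vs as [|[l r] vs IH]; simpl; [lra|].
rewrite <- avgL_avg3.
eapply Rle_trans; [|apply Rmult_le_compat_l; [|exact IH]]; [|lra].
rewrite <- avgL_scal. apply avgL_le. intros cs _.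
rewrite (avg3_ext _ (fun i j k => inner_weight vs cs c *
   (1 + 15 * ind (~ ib i j k (nested_word vs cs c))))) by (intros; ring).
rewrite avg3_scal, avg3_plus, avg3_const, avg3_scal.
specialize (inner_rare (nested_word vs cs c)). pose proof (inner_weight_ge0 vs c cs). nra.
Qed.

Lemma failure_nested_bounded : nested_bounded 1 (fun w => ind (~ good w)).
Proof.
intros vs c.
set (n := length vs).
assert (p4 : 0 < 4 ^ n) by (apply pow_lt; lra).
eapply Rle_trans; [apply (avgL_le n _ (fun cs => / (2 * 4 ^ n) *
  (outer_weight gone gone vs cs + inner_weight vs cs c)))|].
- intros cs Hcs. pose proof (outer_weight_ge0 vs gone gone cs) as O0.
  pose proof (inner_weight_ge0 vs c cs) as I0.
  set (O := outer_weight gone gone vs cs) in *. set (I := inner_weight vs cs c) in *.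
  pose proof (Rinv_0_lt_compat (2 * 4 ^ n) ltac:(lra)) as i0.
  destruct (classic (good (nested_word vs cs c))) as [Hg|Hg].
  { rewrite ind_false by tauto. apply Rmult_le_pos; lra. }
  rewrite ind_true by exact Hg.
  pose proof (weight_of_failure vs c gone gone cs Hcs) as W.
  rewrite gmul_1l, gmul_1r in W. specialize (W Hg). fold n O I in W.
  (* AM-GM in squared form: the square of [O + I] is at least [4 * O * I], hence at least
     [4 * 16 ^ n]. *)
  assert (S : 2 * 4 ^ n <= O + I).
  { apply Rsqr_incr_0_var; [|lra]. unfold Rsqr.
    replace (2 * 4 ^ n * (2 * 4 ^ n)) with (4 * (4 ^ n * 4 ^ n)) by ring.
    rewrite <- Rpow_mult_distr. replace (4 * 4) with 16 by ring.
    pose proof (Rle_0_sqr (O - I)) as Q. unfold Rsqr in Q. nra. }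
  apply Rmult_le_compat_l with (r := / (2 * 4 ^ n)) in S; [|lra].
  rewrite Rinv_l in S by lra. exact S.
- rewrite avgL_scal, avgL_plus.
  pose proof (avg_outer_weight vs gone gone) as O. pose proof (avg_inner_weight vs c) as I.
  fold n in O, I.
  apply Rle_trans with (/ (2 * 4 ^ n) * (2 ^ n + 2 ^ n)).
  + apply Rmult_le_compat_l; [left; apply Rinv_0_lt_compat; lra|].
    apply Rplus_le_compat; assumption.
  + right. replace 4 with (2 * 2) by ring. rewrite Rpow_mult_distr.
    replace (1 / 2) with (/ 2) by lra. rewrite Rmult_1_l, pow_inv.
    pose proof (pow_lt 2 n ltac:(lra)). field. lra.
Qed.

End Failure.
End Nested.

(** * The theorem *)

(** For natural [n], [sqrt n <= n <= m * (n / m + 1)] with division rounded down. So the [m]-th root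
    of [q] serves as [c], and [B = / q] pays for the rounding. *)
Lemma geometric_le_stretched q m : 0 < q < 1 -> (0 < m)%nat ->
  exists B c, 0 < B /\ 0 < c < 1 /\
    forall n : nat, q ^ (n / m) <= B * Rpower c (sqrt (INR n)).
Proof.
intros Hq Hm.
assert (lq : ln q < 0) by (rewrite <- ln_1; apply ln_increasing; lra).
assert (m0 : 0 < INR m) by now apply lt_0_INR.
exists (/ q), (exp (ln q / INR m)).
split; [apply Rinv_0_lt_compat; lra|]. split.
{ split; [apply exp_pos|]. rewrite <- exp_0. apply exp_increasing.
  unfold Rdiv. pose proof (Rinv_0_lt_compat _ m0). nra. }
intros n. rewrite <- Rpower_pow by lra. unfold Rpower. rewrite ln_exp.
replace (/ q) with (exp (- ln q)) by (rewrite exp_Ropp, exp_ln; lra).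
rewrite <- exp_plus.
assert (H : INR (n / m) * ln q <= - ln q + sqrt (INR n) * (ln q / INR m)).
2:{ destruct H as [H|H]; [left; now apply exp_increasing|right; now rewrite H]. }
assert (Hn : sqrt (INR n) <= INR n).
{ destruct n; [simpl; rewrite sqrt_0; lra|].
  rewrite <- (sqrt_Rsqr (INR (S n))) at 2 by apply pos_INR.
  apply sqrt_le_1_alt. unfold Rsqr. rewrite S_INR. pose proof (pos_INR n). nra. }
assert (Hnm : INR n <= INR m * (INR (n / m) + 1)).
{ rewrite <- S_INR, <- mult_INR. apply le_INR.
  pose proof (Nat.mod_upper_bound n m). pose proof (Nat.div_mod_eq n m). nia. }
assert (A : sqrt (INR n) / INR m <= INR (n / m) + 1) by (apply Rle_div_l; [lra|lra]).
replace (sqrt (INR n) * (ln q / INR m)) with (sqrt (INR n) / INR m * ln q) by (field; lra).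
nra.
Qed.

Lemma avg3_le_fst u c : (forall j k, avg (fun i => u i j k) <= c) -> avg3 u <= c.
Proof.
intros H. unfold avg3. rewrite avg_swap. rewrite <- (avg_const c). apply avg_le. intros j.
rewrite avg_swap. rewrite <- (avg_const c). apply avg_le. intros k. apply H.
Qed.

Lemma avg3_le_snd u c : (forall i k, avg (fun j => u i j k) <= c) -> avg3 u <= c.
Proof.
intros H. unfold avg3. rewrite <- (avg_const c). apply avg_le. intros i.
rewrite avg_swap. rewrite <- (avg_const c). apply avg_le. intros k. apply H.
Qed.

Lemma avg3_le_trd u c : (forall i j, avg (fun k => u i j k) <= c) -> avg3 u <= c.
Proof.
intros H. unfold avg3. rewrite <- (avg_const c). apply avg_le. intros i.
rewrite <- (avg_const c). apply avg_le. intros k. apply H.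
Qed.

Lemma avg3_ind_not_and4 (P1 P2 P3 P4 : nat -> nat -> nat -> Prop) :
  avg3 (fun i j k => ind (~ P1 i j k)) <= / 64 -> avg3 (fun i j k => ind (~ P2 i j k)) <= / 64 ->
  avg3 (fun i j k => ind (~ P3 i j k)) <= / 64 -> avg3 (fun i j k => ind (~ P4 i j k)) <= / 64 ->
  avg3 (fun i j k => ind (~ (P1 i j k /\ P2 i j k /\ P3 i j k /\ P4 i j k))) <= / 16.
Proof.
intros H1 H2 H3 H4.
eapply Rle_trans; [apply (avg3_le _ (fun i j k => ind (~ P1 i j k) +
  (ind (~ P2 i j k) + (ind (~ P3 i j k) + ind (~ P4 i j k)))))|].
- intros i j k. unfold ind. repeat destruct (excluded_middle_informative _); (lra || tauto).
- rewrite !avg3_plus. lra.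
Qed.

Lemma card_le_mono {G : group} (P : G -> Prop) n m : (n <= m)%nat -> card_le P n -> card_le P m.
Proof. intros H HP l H1 H2. specialize (HP l H1 H2). lia. Qed.

Lemma Ex_ind_lb {G : group} (a : nat -> G) (p : nat -> R) (prob : is_prob_seq p) n (E F : G -> Prop) e :
  (forall w, F w -> E w) -> Ex a p n (fun w => ind (~ F w)) <= e ->
  Ex a p n (fun w => ind (E w)) >= 1 - e.
Proof.
intros HFE He.
assert (B : forall P : G -> Prop, bnd 1 (fun w => ind (P w))).
{ intros P w. split; [apply ind_ge0|apply ind_le1]. }
assert (H : Ex a p n (fun _ => 1) <= Ex a p n (fun w => ind (E w) + ind (~ F w))).
{ apply (Ex_le a p prob n 2).
  - intros w. lra.
  - intros w. pose proof (B E w). pose proof (B (fun w => ~ F w) w). simpl in *. lra.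
  - intros w. pose proof (ind_ge0 (E w)). pose proof (ind_ge0 (~ F w)).
    destruct (classic (F w)) as [Hw|Hw].
    + rewrite (ind_true (E w)) by auto. lra.
    + rewrite (ind_true (~ F w)) by auto. lra. }
rewrite (Ex_const a p prob), (Ex_plus a p prob n 1 _ _ (B E) (B (fun w => ~ F w))) in H. lra.
Qed.

(** The exponents of [g] add up to [r * N] for every [i], so all members are reached after equally
    many letters and with the same bound, as [Ex_decay] requires. *)
Lemma schottky_family_reach {G : group} (a : nat -> G) (p : nat -> R) (prob : is_prob_seq p)
    g h r N Q mg mh qg qh i :
  reach a p mg qg g -> reach a p mh qh h -> (i <= r)%nat ->
  reach a p (r * N * mg + Q * mh) (qg ^ (r * N) * qh ^ Q) (schottky_family g h r N Q i).
Proof.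
intros Hg Hh Hi. unfold schottky_family.
replace (r * N * mg + Q * mh)%nat with (i * N * mg + Q * mh + (r - i) * N * mg)%nat.
2:{ replace (r * N)%nat with (i * N + (r - i) * N)%nat by nia. ring. }
replace (qg ^ (r * N) * qh ^ Q) with (qg ^ (i * N) * qh ^ Q * qg ^ ((r - i) * N)).
2:{ replace (r * N)%nat with (i * N + (r - i) * N)%nat by nia. rewrite pow_add. ring. }
repeat apply reach_mul; auto; now apply reach_pow.
Qed.

Theorem theorem1p11 (X : metric_space) (G : group) (act : G -> X -> X) (x : X)
    (a : nat -> G) (p : nat -> R) :
  is_isometric_action G X act ->
  geodesic_space X ->
  (exists delta, 0 <= delta /\ hyperbolic X delta) ->
  is_prob_seq p ->
  non_elementary act x a p ->
  bounded_measure act x a p ->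
  has_WPD act a p ->
  forall K1 C : R, 0 <= K1 -> 0 <= C ->
  forall K : R, 0 <= K ->
  exists (N : nat) (B c : R), (0 < N)%nat /\ 0 < B /\ 0 < c < 1 /\
    forall n : nat,
      (exists r, walk_prob a p n (fun w => card_le (Stab act K x (act w x)) N) r /\
                 r >= 1 - B * Rpower c (sqrt (INR n))) /\
      (exists r, walk_prob a p n
                   (fun w => loxodromic act w /\
                      forall (alpha : R -> X) (q : X),
                        is_axis act K1 w alpha -> closest_point C x alpha q ->
                        card_le (Stab act K q (act w q)) N) r /\
                 r >= 1 - B * Rpower c (sqrt (INR n))).
Proof.
intros isom _ (delta & delta0 & Xhyp) prob (g & h & Sg & Sh & Lg & Lh & Hne) _ (u & Su & [_ Hwpd])
  K1 Cp K10 Cp0 K K0.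
destruct (reach_semigroup a p prob g Sg) as (mg & qg & Rg).
destruct (reach_semigroup a p prob h Sh) as (mh & qh & Rh).
destruct (reach_semigroup a p prob u Su) as (mu & qu & Ru).
destruct (schottky_exists act delta delta0 Xhyp isom g h x 63 Lg Lh Hne) as (C1 & N & C10 & HS).
set (C := C1 + delta).
set (k := 2 * (Cp + 3 * K1 + 2 * delta) + delta + 1).
set (D := 10 * C + 20 * delta + k + 1).
destruct (HS D) as [Q HQ].
set (f := fun i => schottky_family g h 63 N Q (min i 63)).
set (c1 := 5 * C + 20 * delta).
set (c3 := 5 * c1 + Cp + 7 * K1 + 20 * delta).
set (K' := K + 2 * c3 + 2 * delta + 1).
assert (HC0 : 0 <= C) by (unfold C; lra).
assert (c10 : 0 <= c1) by (unfold c1; lra).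
assert (Hk0 : 0 < k) by (unfold k; lra).
destruct (Hwpd K' x) as (M & _ & l & Hl); [unfold K', c3; lra|].
set (hM := gpow u M).
assert (HD : forall i, D <= dist x (act (f i) x)) by (intros i; apply HQ; lia).
assert (sep_r : forall z, avg (fun i => ind (~ gp x z (act (f i) x) <= C)) <= / 64).
{ intros z. apply avg_ind_le. intros i j Hij Hj [H1 H2].
  destruct (HQ i ltac:(lia)) as [_ H]. destruct (H j Hij Hj) as [H3 _].
  unfold f in H1, H2. rewrite !Nat.min_l in * by lia.
  destruct (gp_hyp delta Xhyp x (act (schottky_family g h 63 N Q i) x) z
    (act (schottky_family g h 63 N Q j) x)) as [H4|H4]; [rewrite gp_sym in H4|]; unfold C in *; lra. }
assert (sep_l : forall z, avg (fun i => ind (~ gp x (act (ginv (f i)) x) z <= C)) <= / 64).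
{ intros z. apply avg_ind_le. intros i j Hij Hj [H1 H2].
  destruct (HQ i ltac:(lia)) as [_ H]. destruct (H j Hij Hj) as [_ H3].
  unfold f in H1, H2. rewrite !Nat.min_l in * by lia.
  destruct (gp_hyp delta Xhyp x (act (ginv (schottky_family g h 63 N Q i)) x) z
    (act (ginv (schottky_family g h 63 N Q j)) x)) as [H4|H4];
    [|rewrite gp_sym in H4]; unfold C in *; lra. }
set (ob := fun A B i k => outer_ok act x C A B (f i) (f k)).
set (ib := fun i j k N => inner_ok act x C hM (f i) (f j) (f k) N).
assert (Hob : forall A B, avg3 (fun i j k => ind (~ ob A B i k)) <= / 16).
{ intros A B. apply avg3_ind_not_and4.
  - apply avg3_le_fst. intros. apply sep_r.
  - apply avg3_le_trd. intros. apply sep_l.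
  - apply avg3_le_fst. intros. apply sep_r.
  - apply avg3_le_trd. intros. apply sep_l. }
assert (Hib : forall V, avg3 (fun i j k => ind (~ ib i j k V)) <= / 16).
{ intros V. apply avg3_ind_not_and4.
  - apply avg3_le_fst. intros. apply sep_l.
  - apply avg3_le_snd. intros. apply sep_r.
  - apply avg3_le_snd. intros. apply sep_l.
  - apply avg3_le_trd. intros. apply sep_r. }
pose proof (failure_nested_bounded f hM ob ib Hob Hib) as Hfail.
set (m2 := (63 * N * mg + Q * mh)%nat).
set (q2 := qg ^ (63 * N) * qh ^ Q).
assert (R2 : forall i, reach a p m2 q2 (f i)).
{ intros i. apply schottky_family_reach; auto. lia. }
assert (R1 : forall i j, reach a p (m2 + M * mu + m2) (q2 * qu ^ M * q2) (gmul (gmul (f i) hM) (f j))).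
{ intros i j. apply reach_mul; auto. apply reach_mul; auto. now apply reach_pow. }
set (m1 := (m2 + M * mu + m2)%nat) in *. set (q1 := q2 * qu ^ M * q2) in *.
destruct (R1 0%nat 0%nat) as [Hq1 _]. destruct (R2 0%nat) as [Hq2 _].
destruct (geometric_le_stretched (1 - q1 * q2 / 2) (S (m1 + m2))) as (B & c & B0 & Hc & Hrate);
  [nra|lia|].
assert (Hdecay : forall n, Ex a p n (fun w => ind (~ good f hM ob ib w)) <= B * Rpower c (sqrt (INR n))).
{ intros n. eapply Rle_trans; [|apply Hrate].
  rewrite <- (Rmult_1_l (_ ^ _)).
  apply (Ex_decay f hM a p m1 m2 q1 q2 prob R1 R2); [intros w; apply ind_ge0|exact Hfail|].
  pose proof (Nat.Div0.mul_div_le n (S (m1 + m2))). nia. }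
assert (Hgood : forall w, good f hM ob ib w -> exists b P,
  (forall n, INR n * k <= dist P (act (gpow w n) P)) /\
  forall z, z = act b x \/ z = act (gmul b hM) x -> gp z x (act w x) <= c1 /\
    forall n, gp z (act (gpow (ginv w) n) P) (act (gpow w (S n)) P) <= c1).
{ intros w (A & B' & i & j & k' & V & Ho & Hi & Hw).
  (* This element carries [x] and [hM x] to the ends of the part of the path that spells [hM]. *)
  exists (gmul A (f i)).
  apply (good_word_geometry act delta delta0 Xhyp isom x C D hM A B' (f i) (f j) (f k') V w k); auto.
  - rewrite Hw. unfold block. now rewrite !gmul_assoc.
  - unfold D. lra. }
exists (S (length l)), B, c. split; [lia|]. split; [exact B0|]. split; [exact Hc|].
intros n. split.
- eexists. split; [apply walk_prob_Ex, prob|].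
  apply (Ex_ind_lb a p prob n _ (good f hM ob ib)); [|apply Hdecay].
  intros w Hw. destruct (Hgood w Hw) as (b & P & _ & Hz).
  apply (card_le_mono _ (length l)); [lia|].
  apply (card_le_stab act delta Xhyp isom x b hM K K' c1 x (act w x) l Hl).
  + unfold K', c3. lra.
  + apply Hz. now left.
  + apply Hz. now right.
- eexists. split; [apply walk_prob_Ex, prob|].
  apply (Ex_ind_lb a p prob n _ (good f hM ob ib)); [|apply Hdecay].
  intros w Hw. destruct (Hgood w Hw) as (b & P & Hgrow & Hz).
  split; [exact (loxodromic_of_growth act isom w P k Hk0 Hgrow)|].
  intros alpha q Hax Hq.
  assert (Hnear : forall z, z = act b x \/ z = act (gmul b hM) x -> gp z q (act w q) <= c3).
  { intros z Hzz. destruct (Hz z Hzz) as [H1 H2].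
    apply (gp_axis_projection act delta delta0 Xhyp isom K1 Cp alpha w Cp0 Hax k P x z c1 q);
      auto. unfold k. lra. }
  apply (card_le_mono _ (length l)); [lia|].
  apply (card_le_stab act delta Xhyp isom x b hM K K' c3 q (act w q) l Hl).
  + unfold K'. lra.
  + apply Hnear. now left.
  + apply Hnear. now right.
Qed.
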